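(* Let $\psi$ be a Minkowski norm and $\phi$ a weak Minkowski norm on $\mathbb{R}^2$, and set $\Omega:=\{x\in\mathbb{R}^2:\phi(x)<1\}$. Define $F:\Omega\times\mathbb{R}^2\to\mathbb{R}$ by $$F(x,y):=\psi(y+xP(x,y))\,\{1+x^kP_{y^k}(x,y)\},$$ where $P=P(x,y)$ is the unique solution of $P=\phi(y+xP)$, $(x,y)\in\Omega\times\mathbb{R}^2$, and let $\mathscr O:=\{x\in\Omega:F(x,\cdot)\text{ is a Minkowski norm}\}$. Then the following hold: (i) every connected component of $\mathscr O$ is a convex domain in $\mathbb{R}^2$; (ii) for $\mathcal H^1$-a.e. $x\in\partial\mathscr O\cap\Omega$, if the matrix $([F^2]_{y^iy^j}(x,y))$ is degenerate for some $y\in\mathbb{R}^2\setminus\{\mathbf 0\}$, then $y$ is tangent to $\partial\mathscr O$ at $x$. In particular, such a pair $(x,y)$ exists whenever $\partial\mathscr O\cap\Omega$ is nonempty.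
   Context: Subscripts $y^i$ denote partial derivatives, repeated indices are summed; $\mathcal H^1$ is the $1$-dimensional Hausdorff measure. A pseudo-norm on $\mathbb{R}^2$ is a function $\varphi\ge0$ vanishing only at $\mathbf 0$, with $\varphi(\alpha y)=\alpha\varphi(y)$ for $\alpha>0$ and $\varphi(y_1+y_2)\le\varphi(y_1)+\varphi(y_2)$. It is a weak Minkowski norm if it is smooth on $\mathbb{R}^2\setminus\{\mathbf 0\}$ and equality in the triangle inequality holds only if $\alpha_1y_1=\alpha_2y_2$ for some $\alpha_1,\alpha_2\ge0$, $\alpha_1+\alpha_2>0$. It is a Minkowski norm if moreover $([\varphi^2]_{y^iy^j}(y))$ is positive definite for all $y\ne\mathbf 0$.
   Formalization: ''y is tangent to ∂O at x'' is read as: the line x+Ry misses O near x and is the tangent line at x of the boundary of each component of O having x on its boundary; a tangent line of all of ∂O can fail where infinitely many components accumulate. *)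

(* Defs.v *)
From HB Require Import structures.
From mathcomp Require Import all_boot all_order all_algebra.
From mathcomp Require Import all_classical all_reals all_analysis.
From mathcomp Require Import lra.

Set Implicit Arguments.
Unset Strict Implicit.
Unset Printing Implicit Defensive.

Import Order.TTheory GRing.Theory Num.Theory.
Import numFieldNormedType.Exports.

Local Open Scope classical_set_scope.
Local Open Scope ring_scope.

Section calculus.
Context {R : realType}.
Local Notation plane := 'rV[R]_2.
Implicit Types (f : plane -> R) (x y : plane) (U : set plane).

Definition basis_vec (i : 'I_2) : plane := delta_mx 0 i.

Definition partial (i : 'I_2) f : plane -> R := fun y => 'D_(basis_vec i) f y.

Definition iter_partial (s : seq 'I_2) f : plane -> R := foldr partial f s.

(* C^oo on the open set U: partial derivatives of all orders exist and are
   continuous at the points of U. *)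
Definition smooth_on U f : Prop :=
  forall (s : seq 'I_2) y, U y ->
    {for y, continuous (iter_partial s f)} /\
    (forall i, derivable (iter_partial s f) y (basis_vec i)).

Definition hessian f y : 'M[R]_2 :=
  \matrix_(i < 2, j < 2) partial j (partial i f) y.

Definition pos_def (A : 'M[R]_2) : Prop :=
  forall v : plane, v != 0 -> 0 < (v *m A *m v^T) 0 0.

End calculus.

Section norms.
Context {R : realType}.
Local Notation plane := 'rV[R]_2.
Implicit Types (f : plane -> R).

Definition pseudo_norm f : Prop :=
  [/\ forall y, 0 <= f y,
      forall y, f y = 0 <-> y = 0,
      forall (a : R) y, 0 < a -> f (a *: y) = a * f y &
      forall y1 y2, f (y1 + y2) <= f y1 + f y2].

Definition weak_Minkowski_norm f : Prop :=
  [/\ pseudo_norm f,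
      smooth_on [set y | y != 0] f &
      forall y1 y2, f (y1 + y2) = f y1 + f y2 ->
        exists a1 a2 : R,
          [/\ 0 <= a1, 0 <= a2, 0 < a1 + a2 & a1 *: y1 = a2 *: y2]].

Definition Minkowski_norm f : Prop :=
  weak_Minkowski_norm f /\
  forall y, y != 0 -> pos_def (hessian (fun z => f z ^+ 2) y).

End norms.

Section metric.
Context {R : realType}.
Local Notation plane := 'rV[R]_2.
Variables (psi phi : plane -> R).

Definition Omega : set plane := [set x | phi x < 1].

(* [get A] is the element of A when there is exactly one;
   see [funkP_exists_unique]. *)
Definition funkP (x y : plane) : R := get [set p : R | p = phi (y + p *: x)].

Definition metricF (x y : plane) : R :=
  psi (y + funkP x y *: x) *
  (1 + \sum_(k < 2) x 0 k * partial k (funkP x) y).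

Definition Mink_locus : set plane := [set x | Omega x /\ Minkowski_norm (metricF x)].

Definition degenerate (x y : plane) : Prop :=
  hessian (fun z => metricF x z ^+ 2) y \notin unitmx.

Lemma funkP_exists_unique (x y : plane) :
  pseudo_norm phi -> Omega x -> exists! p : R, p = phi (y + p *: x).
Proof.
move=> [phi_ge0 _ phiZ phiD]; rewrite /Omega /= => x1.
have incr p q : p < q -> phi (y + q *: x) <= phi (y + p *: x) + (q - p) * phi x.
  move=> pq; rewrite -phiZ ?subr_gt0//.
  by rewrite [X in phi X](_ : _ = (y + p *: x) + (q - p) *: x) ?phiD//
    -addrA -scalerDl subrKC.
have decr p q : p < q ->
    phi (y + p *: x) <= phi (y + q *: x) + (q - p) * phi (- x).
  move=> pq; rewrite -phiZ ?subr_gt0//.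
  by rewrite [X in phi X](_ : _ = (y + q *: x) + (q - p) *: (- x)) ?phiD//
    scalerN -scaleNr -addrA -scalerDl opprB subrKC.
pose M := phi x + phi (- x) + 1.
have M0 : 0 < M by rewrite /M; have := phi_ge0 x; have := phi_ge0 (- x); lra.
have lip p q : `|phi (y + p *: x) - phi (y + q *: x)| <= M * `|p - q|.
  wlog pq : p q / p <= q.
    move=> H; have [/H//|/ltW/H] := leP p q.
    by rewrite distrC (distrC q).
  move: pq; rewrite le_eqVlt => /predU1P[->|pq]; first by rewrite !subrr !normr0 mulr0.
  have h1 := incr _ _ pq; have h2 := decr _ _ pq.
  have qp : 0 < q - p by lra.
  have h3 : 0 <= (q - p) * phi x by rewrite mulr_ge0// ltW.
  have h4 : 0 <= (q - p) * phi (- x) by rewrite mulr_ge0// ltW.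
  rewrite (distrC p) (gtr0_norm qp) ler_norml /M; apply/andP; split; nra.
have cphi : continuous (fun p : R => p - phi (y + p *: x)).
  move=> p; apply: cvgB; first exact: cvg_id.
  apply/cvgrPdist_lt => e e0; near=> q.
  apply: (le_lt_trans (lip p q)); rewrite mulrC -ltr_pdivlMr//.
  by near: q; apply/nbhs_ballP; exists (e / M); rewrite /= ?divr_gt0.
have [p pE] : exists p : R, p = phi (y + p *: x).
  pose b := phi y / (1 - phi x).
  have b0 : 0 <= b by rewrite divr_ge0// subr_ge0 ltW.
  have [||c _ cE] := @IVT R (fun p : R => p - phi (y + p *: x)) 0 b 0 b0.
  - by apply: continuous_subspaceT => ?; exact: cphi.
  - have hb : phi (y + b *: x) <= b.
      have bE : b * (1 - phi x) = phi y by rewrite divfK// gt_eqF// subr_gt0.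
      move: b0; rewrite le_eqVlt => /predU1P[b0|b0].
        rewrite -b0 scale0r addr0; move: bE; rewrite -b0 mul0r => <-//.
      by have := phiD y (b *: x); rewrite phiZ//; lra.
    rewrite scale0r addr0 ge_min le_max; have := phi_ge0 y => hy.
    by apply/andP; split; apply/orP; [left|right]; lra.
  - by exists c; apply/eqP; rewrite -subr_eq0 cE.
exists p; split => // q qE.
have lt_contra (a c : R) : a = phi (y + a *: x) -> c = phi (y + c *: x) ->
    a < c -> False.
  move=> aE cE ac; have := incr _ _ ac; rewrite -aE -cE; nra.
by have [/(lt_contra _ _ pE qE)//|/(lt_contra _ _ qE pE)//|//] := ltgtP p q.
Unshelve. all: by end_near.
Qed.

End metric.

Section boundaries.
Context {R : realType}.
Local Notation plane := 'rV[R]_2.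
Implicit Types (A C O : set plane) (x y : plane).

Definition boundary A : set plane := closure A `\` A^°.

Definition components A : set (set plane) :=
  [set connected_component A x | x in A].

Definition domain A : Prop := [/\ A !=set0, open A & connected A].

(* Bouligand's tangent cone of A at x (Federer's Tan(A, x)). *)
Definition tangent_cone A x : set plane :=
  [set v | forall e : R, 0 < e -> exists p (r : R),
     [/\ A p, 0 < r, `|p - x| < e & `|r *: (p - x) - v| < e]].

(* A has a tangent line at x, and this line is x + R y. *)
Definition tangent_line A x y : Prop :=
  y != 0 /\ tangent_cone A x = [set t *: y | t in [set: R]].

(* Tangency of y at x to the boundary of an open set O, possibly with infinitely
   many components: the line x + R y touches O at x without entering it, and is
   the tangent line at x of the boundary of every component of O adherent to x.
   [tangent_line (boundary O) x y] would be too strong where components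
   accumulate: for the complement of a fat Cantor family of parallel lines, the
   tangent cone of the boundary is the whole plane on a set of positive
   measure. *)
Definition tangent_to_boundary O x y : Prop :=
  [/\ y != 0,
      \forall t \near (0 : R), ~ O (x + t *: y) &
      forall C, components O C -> boundary C x -> tangent_line (boundary C) x y].

End boundaries.

Section hausdorff.
Context {R : realType}.
Local Notation plane := 'rV[R]_2.
Implicit Types (A U : set plane).
Local Open Scope ereal_scope.

(* The norm of 'rV[R]_2 in the library is the sup norm, whence an explicit
   Euclidean norm. *)
Definition euclid (v : plane) : R := Num.sqrt (\sum_(k < 2) v 0%R k ^+ 2)%R.

(* The added 0 only matters for U = set0, whose supremum would be -oo. *)
Definition diam U : \bar R :=
  ereal_sup (0 |` [set d | exists p q, [/\ U p, U q & d = (euclid (p - q))%:E]]).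

Definition hausdorff1_content (delta : R) A : \bar R :=
  ereal_inf [set \sum_(0 <= i <oo) diam (U i) | U in
    [set U : nat -> set plane |
      A `<=` \bigcup_i U i /\ forall i, diam (U i) <= delta%:E]].

Definition hausdorff1 A : \bar R :=
  ereal_sup [set hausdorff1_content delta A | delta in [set d : R | (0 < d)%R]].

(* Q holds at H^1-almost every point of A. *)
Definition H1_ae_in A (Q : plane -> Prop) : Prop :=
  hausdorff1 [set x | A x /\ ~ Q x] = 0.

End hausdorff.

(* Main.v *)
Require Import Defs.
From HB Require Import structures.
From mathcomp Require Import all_boot all_order all_algebra.
From mathcomp Require Import all_classical all_reals all_analysis.
From mathcomp Require Import ring lra.

Set Implicit Arguments.
Unset Strict Implicit.
Unset Printing Implicit Defensive.

Import Order.TTheory GRing.Theory Num.Theory.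
Import numFieldNormedType.Exports.

Local Open Scope classical_set_scope.
Local Open Scope ring_scope.

(** Put [z = y + P(x,y) x], so that [P = phi z] and [y = z - phi(z) x]; then
    [F(x,y) = psi(z) / D] with [D = 1 - dphi_z(x)], which is positive on [Omega].
    A positively homogeneous [F] has Hessian [lambda(y) J J^T], where [J] is [y]
    turned by a right angle, and the Hessian of [F^2] is positive definite
    (resp. degenerate) iff [lambda > 0] (resp. [lambda = 0]).
    Differentiating [F] along the curve [t |-> z(t) - phi(z(t)) x], where [z(t)]
    runs along the line through [z] orthogonal to [z], gives, up to a positive
    factor,
      [lambda = A(z) D^2 + B(z) D b + C(z) b^2],  [b = det(z, x) / |z|^2].
    Its sign depends on [x] only through [b / D], that is, only through the line
    joining [x] to [z / phi(z)], whose direction is [y]. Hence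
    - [b / D] maps a component of [O] onto an interval and is monotone on
      segments, so components are convex;
    - if [(x,y)] is degenerate then the whole line [x + R y] misses [O], so it
      supports every component adherent to [x]. It is the tangent line there
      unless the component has two independent supporting lines at [x]; such an
      [x] is the unique minimiser of a rational linear form on the closure of the
      component, and there are only countably many components and rational forms. *)

(** * Functions of class C^k on the plane *)

Section plane_calculus.
Context {R : realType}.
Local Notation plane := 'rV[R]_2.
Implicit Types (f g : plane -> R) (x y z v : plane) (U : set plane).

Lemma sum_ord2 (V : nmodType) (F : 'I_2 -> V) : \sum_(i < 2) F i = F 0 + F 1.
Proof.
rewrite big_ord_recl big_ord1; congr (_ + F _); exact: val_inj.
Qed.

Lemma forall_ord2 (Q : 'I_2 -> Prop) : Q 0 -> Q 1 -> forall i, Q i.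
Proof.
move=> Q0 Q1 [[|[|//]] H].
  by rewrite (_ : Ordinal _ = 0)//; exact: val_inj.
by rewrite (_ : Ordinal _ = 1)//; exact: val_inj.
Qed.

Lemma plane_eqP x y : x 0 0 = y 0 0 -> x 0 1 = y 0 1 -> x = y.
Proof. by move=> h0 h1; apply/rowP; apply: forall_ord2. Qed.

Lemma plane_basis h : h = h 0 0 *: basis_vec 0 + h 0 1 *: basis_vec 1 :> plane.
Proof. by apply: plane_eqP; rewrite !mxE /=; ring. Qed.

Lemma norm_coord x i : `|x 0 i| <= `|x|.
Proof.
rewrite [leRHS]/Num.Def.normr/= mx_normrE.
exact: le_trans (le_bigmax _ _ (0, i)).
Qed.

Lemma norm_plane_lt x (r : R) : 0 < r -> `|x 0 0| < r -> `|x 0 1| < r -> `|x| < r.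
Proof.
move=> r0 h0 h1; rewrite [ltLHS]/Num.Def.normr/= mx_normrE (bigmax_lt _ r0)//= => -[i j] _ /=.
by rewrite ord1; move: j; apply: forall_ord2.
Qed.

Lemma is_derive_line f x v t :
  derivable f (x + t *: v) v ->
  is_derive t 1 (fun s : R => f (x + s *: v)) ('D_v f (x + t *: v)).
Proof.
move=> df.
have E : (fun h : R => h^-1 *: (((fun s : R => f (x + s *: v)) \o shift t) (h *: 1) - f (x + t *: v)))
  = (fun h : R => h^-1 *: ((f \o shift (x + t *: v)) (h *: v) - f (x + t *: v))).
  apply/funext => h /=; congr (_ *: (f _ - _)).
  by rewrite -[h%:A]/(h * 1) mulr1 scalerDl addrCA.
by split; rewrite /derivable /derive E.
Qed.

(** Mean value theorem on the segment from [x] to [x + s *: v]. Here [c] plays the part of the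
    derivative at a base point, and [e] bounds the oscillation of the actual one. *)
Lemma line_increment f x v (s c e : R) :
  (forall t : R, `|t| <= `|s| ->
     derivable f (x + t *: v) v /\ `|'D_v f (x + t *: v) - c| <= e) ->
  `|f (x + s *: v) - f x - s * c| <= e * `|s|.
Proof.
move=> H; pose g (t : R) := f (x + t *: v).
have dg (t : R) : `|t| <= `|s| -> is_derive t 1 g ('D_v f (x + t *: v)).
  by move=> /H[+ _]; exact: is_derive_line.
have g0 : g 0 = f x by rewrite /g scale0r addr0.
have cont (a b : R) : (forall t : R, t \in `[a, b] -> `|t| <= `|s|) ->
    {within `[a, b], continuous g}.
  move=> ab; apply: derivable_within_continuous => t /ab /dg[//].
have MV (a b : R) : a <= b -> (forall t : R, t \in `[a, b] -> `|t| <= `|s|) ->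
    `|g b - g a - (b - a) * c| <= e * (b - a).
  move=> ab abs; have [||t tab ->] := @MVT_segment _ g (fun t => 'D_v f (x + t *: v)) a b ab.
  - by move=> t tab; apply/dg/abs; exact: subset_itv_oo_cc tab.
  - exact: cont.
  rewrite [X in X - _]mulrC -mulrBr normrM (ger0_norm (_ : 0 <= b - a)) ?subr_ge0// mulrC.
  by rewrite ler_wpM2r ?subr_ge0//; have [] := H _ (abs _ tab).
rewrite -g0 -/(g s); have [s0|s0] := leP 0 s.
  have := MV 0 s s0; rewrite subr0 (ger0_norm s0); apply=> t; rewrite in_itv/= => /andP[t0 ts].
  by rewrite ger0_norm.
have := MV s 0 (ltW s0); rewrite (ltr0_norm s0) sub0r -normrN.
rewrite (_ : - (g 0 - g s - - s * c) = g s - g 0 - s * c); last by ring.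
by apply=> t; rewrite in_itv/= => /andP[t0 ts]; rewrite !ler0_norm ?lerN2// ltW.
Qed.

(** The differential at [x] applied to [v], in coordinates, so that it makes sense before
    differentiability is known. *)
Definition grad f x v : R := v 0 0 * partial 0 f x + v 0 1 * partial 1 f x.

(** The path from [x] to [x + h] is split into two legs parallel to the axes. In the sup norm both
    legs stay in the ball where the partial derivatives vary by at most [e / 2], and each has length
    at most that of [h]. *)
Lemma C1_increment f x :
  (\forall z \near x, forall i, derivable f z (basis_vec i)) ->
  (forall i, {for x, continuous (partial i f)}) ->
  forall e : R, 0 < e -> \forall h \near (0 : plane),
    `|f (x + h) - f x - grad f x h| <= e * `|h|.
Proof.
move=> df cf e e0.
have e20 : 0 < e / 2 by rewrite divr_gt0.
have near_c i : \forall z \near x, `|partial i f z - partial i f x| <= e / 2.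
  by have /cvgrPdist_le/(_ _ e20) := cf i; apply: filterS => z; rewrite distrC.
have /nbhs_ballP[d /= d0 Hd] : \forall z \near x,
  (forall i, derivable f z (basis_vec i)) /\
  (`|partial 0 f z - partial 0 f x| <= e / 2 /\ `|partial 1 f z - partial 1 f x| <= e / 2).
  by apply: filterI df _; apply: filterI; exact: near_c.
apply/nbhs_ballP; exists d => //= h; rewrite -ball_normE /ball_/= sub0r normrN => hd.
have h0d : `|h 0 0| < d by exact: le_lt_trans (norm_coord _ _) hd.
have h1d : `|h 0 1| < d by exact: le_lt_trans (norm_coord _ _) hd.
have inb z : `|z| < d -> ball x d (x + z).
  by rewrite -ball_normE /ball_/= opprD addNKr normrN.
have hE : x + h = x + h 0 0 *: basis_vec 0 + h 0 1 *: basis_vec 1.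
  by rewrite [in LHS](plane_basis h) addrA.
have H0 : `|f (x + h 0 0 *: basis_vec 0) - f x - h 0 0 * partial 0 f x| <= e / 2 * `|h 0 0|.
  apply: line_increment => t th.
  have /inb/Hd[dz [d0z _]] : `|t *: (basis_vec 0 : plane)| < d.
    apply: norm_plane_lt => //; rewrite !mxE /= ?mulr1 ?mulr0 ?normr0//.
    exact: le_lt_trans th h0d.
  by split.
have H1 : `|f (x + h) - f (x + h 0 0 *: basis_vec 0) - h 0 1 * partial 1 f x| <= e / 2 * `|h 0 1|.
  rewrite hE; apply: line_increment => t th; rewrite -addrA.
  have /inb/Hd[dz [_ d0z]] : `|h 0 0 *: basis_vec 0 + t *: (basis_vec 1 : plane)| < d.
    apply: norm_plane_lt => //; rewrite !mxE /= ?mulr1 ?mulr0 ?normr0 ?addr0 ?add0r//.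
    exact: le_lt_trans th h1d.
  by split.
have n0 := norm_coord h 0; have n1 := norm_coord h 1.
have split_sub (a b c u w : R) : a - c - (u + w) = (a - b - w) + (b - c - u) by ring.
rewrite /grad (split_sub _ (f (x + h 0 0 *: basis_vec 0))).
apply: le_trans (ler_normD _ _) _; apply: le_trans (lerD H1 H0) _.
by rewrite -mulrDr [leRHS](_ : _ = e / 2 * (`|h| + `|h|)) ?ler_wpM2l ?lerD ?(ltW e20)//; field.
Qed.

End plane_calculus.

(** * Pointwise continuity *)

Section continuity.
Context {R : realType}.
Local Notation plane := 'rV[R]_2.

Lemma cont_cst (T : topologicalType) (c : R) (x : T) :
  {for x, continuous (fun _ : T => c)}.
Proof. exact: cvg_cst. Qed.

Lemma cont_eps (T : topologicalType) (f : T -> R) (x : T) :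
  (forall e : R, 0 < e -> \forall z \near x, `|f z - f x| < e) -> {for x, continuous f}.
Proof.
by move=> H; apply/cvgrPdist_lt => e e0; near=> z; rewrite distrC; near: z; exact: H.
Unshelve. all: by end_near. Qed.

Lemma cont_add (T : topologicalType) (f g : T -> R) (x : T) :
  {for x, continuous f} -> {for x, continuous g} ->
  {for x, continuous (fun z => f z + g z)}.
Proof. exact: cvgD. Qed.

Lemma cont_opp (T : topologicalType) (f : T -> R) (x : T) :
  {for x, continuous f} -> {for x, continuous (fun z => - f z)}.
Proof. exact: cvgN. Qed.

Lemma cont_mul (T : topologicalType) (f g : T -> R) (x : T) :
  {for x, continuous f} -> {for x, continuous g} ->
  {for x, continuous (fun z => f z * g z)}.
Proof. exact: cvgM. Qed.

Lemma cont_inv (T : topologicalType) (f : T -> R) (x : T) : f x != 0 ->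
  {for x, continuous f} -> {for x, continuous (fun z => (f z)^-1)}.
Proof. by move=> ? ?; exact: cvgV. Qed.

Lemma cont_plane (T : topologicalType) (f : T -> plane) (x : T) :
  (forall i, {for x, continuous (fun z => f z 0 i)}) -> {for x, continuous f}.
Proof.
move=> cf; apply/cvgrPdist_lt => e e0; near=> z.
apply: norm_plane_lt => //; rewrite !mxE; near: z.
  by have /cvgrPdist_lt/(_ _ e0) := cf 0.
by have /cvgrPdist_lt/(_ _ e0) := cf 1.
Unshelve. all: by end_near. Qed.

Lemma cont_coord (T : topologicalType) (f : T -> plane) (x : T) i :
  {for x, continuous f} -> {for x, continuous (fun z => f z 0 i)}.
Proof.
by move=> cf; exact: (continuous_comp cf (@coord_continuous _ _ _ 0 i (f x))).
Qed.

End continuity.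

(** * Differentiability from continuous partial derivatives, and the chain rule along curves *)

Section chain_rule.
Context {R : realType}.
Local Notation plane := 'rV[R]_2.
Implicit Types (f g : plane -> R) (x y z v : plane) (U : set plane).

Lemma grad_is_linear f x : linear (grad f x).
Proof.
move=> a u w; rewrite /grad !mxE -[a *: _]/(a * _).
by move: (partial 0 f x) (partial 1 f x) (u 0 0) (u 0 1) (w 0 0) (w 0 1) => *; ring.
Qed.

HB.instance Definition _ f x :=
  GRing.isLinear.Build R plane R *:%R (grad f x) (@grad_is_linear f x).

Lemma grad_continuous f x : continuous (grad f x).
Proof.
move=> y; suff: {for y, continuous (grad f x)} by [].
by apply: cont_add; apply: cont_mul; try exact: cont_cst; exact: coord_continuous.
Qed.

Definition C1_at f x :=
  (\forall z \near x, forall i, derivable f z (basis_vec i)) /\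
  (forall i, {for x, continuous (partial i f)}).

Lemma C1_differentiable f x : C1_at f x ->
  differentiable f x /\ 'd f x = grad f x :> (plane -> R).
Proof.
move=> [df cf].
have E : (f : plane -> R^o) \o shift x = cst (f x : R^o) + (grad f x : plane -> R^o) +o_ (0 : plane) id.
  apply/eqaddoP => _/posnumP[e].
  near=> h; rewrite /= !fctE opprD addrA (addrC h).
  by near: h; exact: (C1_increment df cf (gt0 e)).
have D : 'd f x = grad f x :> (plane -> R).
  by apply: diff_unique E; exact: grad_continuous.
by split => //; apply/diff_locallyP; rewrite D; split => //; exact: grad_continuous.
Unshelve. all: by end_near. Qed.

Lemma C1_derive f x v : C1_at f x -> is_derive x v f (grad f x v).
Proof.
move=> /C1_differentiable[df dE]; split; first exact: diff_derivable.
by rewrite deriveE// dE.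
Qed.

Lemma is_derive_curve f (c : R -> plane) (t : R) (d : plane) :
  C1_at f (c t) -> (forall i, is_derive t 1 (fun s => c s 0 i) (d 0 i)) ->
  is_derive t 1 (fun s => f (c s)) (grad f (c t) d).
Proof.
move=> /C1_differentiable[df dE] dc.
have dcv : derivable c t 1.
  by apply/derivable_mxP => i j; rewrite ord1; have [] := dc j.
have cE : 'D_1 c t = d.
  rewrite derive_mx//; apply/rowP => j; rewrite !mxE; exact: derive_val.
have dct : differentiable c t by exact/derivable1_diffP.
have dfc : differentiable (f \o c) t by exact: differentiable_comp.
split; first exact: diff_derivable.
by rewrite (deriveE _ dfc) diff_comp//= dE -deriveE// cE.
Qed.

Lemma C1_continuous f x : C1_at f x -> {for x, continuous f}.
Proof. by move=> /C1_differentiable[/differentiable_continuous]. Qed.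

Lemma open_near U x : open U -> U x -> \forall z \near x, U z.
Proof. by move=> oU Ux; exact: open_nbhs_nbhs. Qed.

End chain_rule.

Section derivative_rules.
Context {R : realType} {V : normedModType R}.
Implicit Types (f g : V -> R) (x v : V).

Lemma dv_cst x v (c : R) : is_derive x v (fun=> c) 0.
Proof. exact: is_derive_cst. Qed.

Lemma dv_add f g x v a b : is_derive x v f a -> is_derive x v g b ->
  is_derive x v (fun z => f z + g z) (a + b).
Proof. by move=> ? ?; exact: is_deriveD. Qed.

Lemma dv_opp f x v a : is_derive x v f a -> is_derive x v (fun z => - f z) (- a).
Proof. by move=> ?; exact: is_deriveN. Qed.

Lemma dv_mul f g x v a b : is_derive x v f a -> is_derive x v g b ->
  is_derive x v (fun z => f z * g z) (f x * b + g x * a).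
Proof. by move=> ? ?; exact: is_deriveM. Qed.

Lemma dv_inv f x v a : f x != 0 -> is_derive x v f a ->
  is_derive x v (fun z => (f z)^-1) (- (f x) ^-2 * a).
Proof.
by move=> f0 [d dE]; split; [exact: derivableV f0 _|rewrite deriveV// dE].
Qed.

End derivative_rules.

(** * Closure properties of C^k functions *)

Section Ck.
Context {R : realType}.
Local Notation plane := 'rV[R]_2.
Implicit Types (f g : plane -> R) (x y z v : plane) (U : set plane).

Lemma is_derive_lineP f x v d :
  is_derive (0 : R) 1 (fun t : R => f (x + t *: v)) d <-> is_derive x v f d.
Proof.
have E : (fun h : R => h^-1 *: (((fun s : R => f (x + s *: v)) \o shift 0) (h *: 1) - f (x + 0 *: v)))
  = (fun h : R => h^-1 *: ((f \o shift x) (h *: v) - f x)).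
  apply/funext => h /=; rewrite scale0r !addr0; congr (_ *: (f _ - _)).
  by rewrite -[h%:A]/(h * 1) mulr1 addrC.
by split=> -[d1 d2]; split; move: d1 d2; rewrite /derivable /derive E.
Qed.

Lemma near_eq_cont U f g x : open U -> U x -> (forall z, U z -> f z = g z) ->
  {for x, continuous f} -> {for x, continuous g}.
Proof.
move=> oU Ux fg cf.
have fgx : {near x, f =1 g}.
  by near=> z; apply: fg; near: z; exact: open_near.
have gE := near_eq_cvg fgx.
suff: g z @[z --> x] --> f x by rewrite fg.
exact: cvg_trans (gE _) cf.
Unshelve. all: by end_near. Qed.

Lemma near_eq_is_derive_on U f g x v d : open U -> U x -> (forall z, U z -> f z = g z) ->
  is_derive x v f d -> is_derive x v g d.
Proof.
move=> oU Ux fg; have [->|v0] := eqVneq v 0.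
  by move=> [_]; rewrite derive0 => <-; exact: is_derive0.
apply: near_eq_is_derive => //.
by near=> z; rewrite fg//; near: z; exact: open_near.
Unshelve. all: by end_near. Qed.

(** The recursion runs on first partial derivatives instead of words of derivatives, so that
    products, inverses and composites are handled by induction on [n]. *)
Fixpoint Ck n U f : Prop :=
  (forall z, U z -> {for z, continuous f}) /\
  if n is n'.+1 then
    (forall z i, U z -> derivable f z (basis_vec i)) /\
    (forall i, Ck n' U (partial i f))
  else True.

Lemma iter_partial_rcons s i f :
  iter_partial (rcons s i) f = iter_partial s (partial i f).
Proof. by rewrite /iter_partial foldr_rcons. Qed.

Lemma smooth_onP U f : smooth_on U f <-> forall n, Ck n U f.
Proof.
split.
  move=> sf n; elim: n f sf => [|n IH] f sf /=.
    by split => // z Uz; have [] := sf [::] z Uz.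
  split=> [z Uz|]; first by have [] := sf [::] z Uz.
  split=> [z i Uz|i]; first by have [] := sf [::] z Uz.
  by apply: IH => s z Uz; rewrite -iter_partial_rcons; exact: sf.
(* [foldr] applies the last letter of the word first, whence an induction from the right. *)
move=> H s; elim/last_ind: s f H => [|s i IH] f H z Uz.
  have /= [cf [df _]] := H 1%N; split; first exact: cf.
  by move=> i; exact: df.
rewrite iter_partial_rcons; apply: IH => // n.
by have /= [_ [_]] := H n.+1; exact.
Qed.

Lemma Ck_cont n U f z : Ck n U f -> U z -> {for z, continuous f}.
Proof. by case: n => [|n] /= [+ _] Uz; exact. Qed.

Lemma CkS n U f : Ck n.+1 U f -> Ck n U f.
Proof.
elim: n f => [|n IH] f; first by move=> /= [].
move=> [cf [df pf]]; split=> //; split=> // i; exact: IH.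
Qed.

Lemma Ck_partial n U f i : Ck n.+1 U f -> Ck n U (partial i f).
Proof. by move=> [_ [_]]; exact. Qed.

Lemma Ck_C1 n U f z : open U -> Ck n.+1 U f -> U z -> C1_at f z.
Proof.
move=> oU [_ [df pf]] Uz; split; last by move=> i; exact: Ck_cont (pf i) Uz.
by near=> y; move=> i; apply: df; near: y; exact: open_near.
Unshelve. all: by end_near. Qed.

Lemma Ck_ext n U f g : open U -> (forall z, U z -> f z = g z) -> Ck n U f -> Ck n U g.
Proof.
move=> oU; elim: n f g => [|n IH] f g fg /= [cf H].
  by split=> // z Uz; apply: (near_eq_cont oU Uz fg); exact: cf.
split=> [z Uz|]; first by apply: (near_eq_cont oU Uz fg); exact: cf.
have D z i : U z -> is_derive z (basis_vec i) g (partial i f z).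
  move=> Uz; apply: (near_eq_is_derive_on oU Uz fg).
  by apply: derivableP; exact: H.1.
split=> [z i Uz|i]; first by have [] := D z i Uz.
by apply: IH (H.2 i) => z Uz; rewrite /partial; have /@derive_val := D z i Uz.
Qed.

(** Continuity of [f] itself follows from the existence and continuity of its partial derivatives;
    it is enough to exhibit the latter. *)
Lemma Ck_intro n U f (F : 'I_2 -> plane -> R) : open U ->
  (forall z i, U z -> is_derive z (basis_vec i) f (F i z)) ->
  (forall i, Ck n U (F i)) -> Ck n.+1 U f.
Proof.
move=> oU df cF.
have pE i z : U z -> F i z = partial i f z.
  by move=> Uz; rewrite /partial; have /@derive_val := df z i Uz.
have cp i : Ck n U (partial i f) by apply: Ck_ext (cF i) => // z; exact: pE.
have dd z i : U z -> derivable f z (basis_vec i).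
  by move=> Uz; have [] := df z i Uz.
split=> // z Uz; apply: C1_continuous; split.
  by near=> y; move=> i; apply: dd; near: y; exact: open_near.
by move=> i; exact: Ck_cont (cp i) Uz.
Unshelve. all: by end_near. Qed.

Lemma Ck_cst n U (c : R) : open U -> Ck n U (fun=> c).
Proof.
move=> oU; elim: n c => [|n IH] c; first by split=> // z _; exact: cont_cst.
by apply: (@Ck_intro _ _ _ (fun _ _ => 0)) => // z i _; exact: is_derive_cst.
Qed.

Lemma coord_derive z v i : is_derive z v (fun y : plane => y 0 i) (v 0 i).
Proof.
apply/is_derive_lineP.
rewrite (_ : (fun t : R => _) = (fun t => z 0 i + t * v 0 i)); last first.
  by apply/funext => t; rewrite !mxE.
apply: is_derive_eq (dv_add (dv_cst _ _ _) (dv_mul (is_derive_id _ _) (dv_cst _ _ _))) _.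
by rewrite mul0r !add0r mulr1.
Qed.

Lemma Ck_coord n U i : open U -> Ck n U (fun y => y 0 i).
Proof.
move=> oU; case: n => [|n]; first by split=> // z _; exact: coord_continuous.
apply: (@Ck_intro _ _ _ (fun j _ => (basis_vec j : plane) 0 i)) => //.
  by move=> z j _; exact: coord_derive.
by move=> j; exact: Ck_cst.
Qed.

Lemma Ck_is_derive n U f z i : Ck n.+1 U f -> U z ->
  is_derive z (basis_vec i) f (partial i f z).
Proof. by move=> [_ [df _]] Uz; exact/derivableP/df. Qed.

Lemma Ck_add n U f g : open U -> Ck n U f -> Ck n U g -> Ck n U (fun z => f z + g z).
Proof.
move=> oU; elim: n f g => [|n IH] f g cf cg.
  by split=> // z Uz; apply: cont_add; [exact: Ck_cont cf Uz|exact: Ck_cont cg Uz].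
apply: (@Ck_intro _ _ _ (fun i z => partial i f z + partial i g z)) => //.
  by move=> z i Uz; apply: dv_add; [exact: Ck_is_derive cf Uz|exact: Ck_is_derive cg Uz].
by move=> i; apply: IH; exact: Ck_partial.
Qed.

Lemma Ck_mul n U f g : open U -> Ck n U f -> Ck n U g -> Ck n U (fun z => f z * g z).
Proof.
move=> oU; elim: n f g => [|n IH] f g cf cg.
  by split=> // z Uz; apply: cont_mul; [exact: Ck_cont cf Uz|exact: Ck_cont cg Uz].
apply: (@Ck_intro _ _ _ (fun i z => f z * partial i g z + g z * partial i f z)) => //.
  by move=> z i Uz; apply: dv_mul; [exact: Ck_is_derive cf Uz|exact: Ck_is_derive cg Uz].
by move=> i; apply: Ck_add => //; apply: IH; try exact: CkS; exact: Ck_partial.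
Qed.

Lemma Ck_opp n U f : open U -> Ck n U f -> Ck n U (fun z => - f z).
Proof.
move=> oU cf; apply: (@Ck_ext _ _ (fun z => -1 * f z)) => //.
  by move=> z _; rewrite mulN1r.
by apply: Ck_mul => //; exact: Ck_cst.
Qed.

Lemma Ck_inv n U f : open U -> (forall z, U z -> f z != 0) -> Ck n U f ->
  Ck n U (fun z => (f z)^-1).
Proof.
move=> oU f0; elim: n f f0 => [|n IH] f f0 cf.
  by split=> // z Uz; apply: cont_inv; [exact: f0|exact: Ck_cont cf Uz].
apply: (@Ck_intro _ _ _ (fun i z => - ((f z)^-1 * (f z)^-1 * partial i f z))) => //.
  move=> z i Uz; apply: is_derive_eq (dv_inv (f0 _ Uz) (Ck_is_derive i cf Uz)) _.
  by rewrite mulNr -invfM.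
move=> i; apply: Ck_opp => //; apply: Ck_mul => //; last exact: Ck_partial.
by apply: Ck_mul => //; apply: IH => //; exact: CkS.
Qed.

Lemma Ck_comp n U V f (g : plane -> plane) : open U -> open V ->
  (forall z, U z -> V (g z)) -> (forall i, Ck n U (fun z => g z 0 i)) -> Ck n V f ->
  Ck n U (fun z => f (g z)).
Proof.
move=> oU oV gUV; elim: n f => [|n IH] f cg cf.
  split=> // z Uz; have cgz : {for z, continuous g}.
    by apply: cont_plane => i; exact: Ck_cont (cg i) Uz.
  exact: (continuous_comp cgz (Ck_cont cf (gUV _ Uz))).
apply: (@Ck_intro _ _ _ (fun i z =>
    partial i (fun z => g z 0 0) z * partial 0 f (g z) +
    partial i (fun z => g z 0 1) z * partial 1 f (g z))) => //.
  move=> z i Uz; apply/is_derive_lineP.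
  have c0 : g (z + (0 : R) *: basis_vec i) = g z by rewrite scale0r addr0.
  have := @is_derive_curve R f (fun t => g (z + t *: basis_vec i)) 0
    (\row_j partial i (fun z => g z 0 j) z).
  rewrite /= c0 /grad !mxE; apply; first exact: Ck_C1 cf (gUV _ Uz).
  move=> j; rewrite mxE; apply/(is_derive_lineP (fun y => g y 0 j)).
  exact: Ck_is_derive (cg j) Uz.
have cg' j : Ck n U (fun z => g z 0 j) by exact: CkS.
have cfg j : Ck n U (fun z => partial j f (g z)) by apply: IH => //; exact: Ck_partial.
by move=> i; apply: Ck_add => //; apply: Ck_mul => //; exact: Ck_partial (cg _).
Qed.

End Ck.

(** * Pseudo-norms and the Funk function *)

Section gradient.
Context {R : realType}.
Local Notation plane := 'rV[R]_2.
Implicit Types (f : plane -> R) (y v : plane).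

Lemma grad_basis f y i : grad f y (basis_vec i) = partial i f y.
Proof.
by move: i; apply: forall_ord2; rewrite /grad !mxE/= mul1r mul0r ?addr0 ?add0r.
Qed.

Lemma gradZ f y (t : R) v : grad f y (t *: v) = t * grad f y v.
Proof. by rewrite /grad !mxE mulrDr !mulrA. Qed.

Lemma gradD f y v w : grad f y (v + w) = grad f y v + grad f y w.
Proof. by rewrite /grad !mxE !mulrDl addrACA. Qed.

End gradient.

Section pseudo_norms.
Context {R : realType}.
Local Notation plane := 'rV[R]_2.
Variable f : plane -> R.
Hypothesis fN : pseudo_norm f.

Lemma pn_ge0 y : 0 <= f y. Proof. by have [] := fN. Qed.
Lemma pnD y z : f (y + z) <= f y + f z. Proof. by have [] := fN. Qed.
Lemma pn00 : f 0 = 0. Proof. by have [_ /(_ 0)[_ ->]] := fN. Qed.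
Lemma pnZ (a : R) y : 0 <= a -> f (a *: y) = a * f y.
Proof.
rewrite le_eqVlt => /predU1P[<-|a0]; first by rewrite scale0r pn00 mul0r.
by have [_ _ ->] := fN.
Qed.
Lemma pn_gt0 y : y != 0 -> 0 < f y.
Proof.
move=> y0; rewrite lt_neqAle pn_ge0 andbT eq_sym; apply: contraNneq y0.
by have [_ + _ _] := fN => /(_ y)[+ _] => /[apply] ->.
Qed.

(** A pseudo-norm need not be symmetric, so both [e] and [- e] enter the bound. *)
Lemma pn_le_coord (t : R) (e : plane) : f (t *: e) <= `|t| * (f e + f (- e)).
Proof.
have [t0|t0] := leP 0 t; first by rewrite pnZ// (ger0_norm t0) ler_wpM2l// lerDl pn_ge0.
rewrite (ltr0_norm t0) -[in leLHS](opprK t) scaleNr -scalerN pnZ ?oppr_ge0 ?(ltW t0)//.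
by apply: ler_wpM2l; rewrite ?oppr_ge0 ?(ltW t0)// lerDr pn_ge0.
Qed.

Lemma pn_bound : exists2 M : R, 0 < M & forall y, f y <= M * `|y|.
Proof.
pose N i := f (basis_vec i) + f (- basis_vec i).
have N0 i : 0 <= N i by rewrite addr_ge0 ?pn_ge0.
exists (N 0 + N 1 + 1) => [|y]; first by rewrite ltr_wpDl// addr_ge0.
rewrite [in leLHS](plane_basis y) (le_trans (pnD _ _))//.
have H i : f (y 0 i *: basis_vec i) <= N i * `|y|.
  apply: (le_trans (pn_le_coord _ _)); rewrite mulrC.
  by apply: (ler_wpM2l (N0 i)); exact: norm_coord.
apply: (le_trans (lerD (H 0) (H 1))); rewrite -mulrDl.
by apply: ler_wpM2r; rewrite ?lerDl.
Qed.

Lemma pn_lipschitz : exists2 M : R, 0 < M & forall y h, `|f (y + h) - f y| <= M * `|h|.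
Proof.
have [M M0 fM] := pn_bound; exists M => // y h.
have h1 := fM h; have h2 := fM (- h); rewrite normrN in h2.
have h3 := pnD y h; have h4 := pnD (y + h) (- h); rewrite addrK in h4.
rewrite ler_norml; apply/andP; split.
  by rewrite lerBrDr addrC lerBlDr (le_trans h4)// lerD2l.
by rewrite lerBlDl (le_trans h3)// lerD2l.
Qed.

Lemma pn_continuous (y : plane) : {for y, continuous f}.
Proof.
have [M M0 fM] := pn_lipschitz.
apply: cont_eps => e e0; apply/nbhs_ballP; exists (e / M); first by rewrite /= divr_gt0.
move=> z; rewrite -ball_normE /= => yz.
rewrite -(subrKC y z) (le_lt_trans (fM _ _))// mulrC -ltr_pdivlMr//.
by rewrite distrC.
Qed.

(** Subadditivity bounds the difference quotients of [f] along [v] by [f v]. For [phi] and [v = x]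
    in [Omega] this makes [1 - dphi(x)] positive. *)
Lemma pn_grad_le y v : C1_at f y -> grad f y v <= f v.
Proof.
move=> [df cf]; apply/ler_addgt0Pr => e e0.
pose e' := e / (`|v| + 1).
have v1 : 0 < `|v| + 1 by rewrite ltr_wpDl.
have e'0 : 0 < e' by rewrite divr_gt0.
have /nbhs_ballP[d /= d0 Hd] := C1_increment df cf e'0.
(* A step short enough for [t *: v] to stay within distance [d]; adding 1 covers [v = 0]. *)
pose t := d / (`|v| + 1) / 2.
have t0 : 0 < t by rewrite !divr_gt0.
have tv : `|t *: v| < d.
  rewrite normrZ gtr0_norm// /t mulrAC ltr_pdivrMr// mulrAC ltr_pdivrMr//.
  have := normr_ge0 v; nra.
have := Hd (t *: v); rewrite -ball_normE /ball_/= sub0r normrN => /(_ tv).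
rewrite normrZ (gtr0_norm t0) => H.
have E : grad f y (t *: v) = t * grad f y v by exact: gradZ.
have K : e' * `|v| <= e.
  by rewrite /e' mulrAC ler_pdivrMr// ler_pM2l// lerDl.
have := pnD y (t *: v); rewrite (pnZ _ (ltW t0)) => H2.
move: H; rewrite E ler_norml => /andP[H _].
rewrite -(ler_pM2l t0) [leRHS]mulrDr.
move: (grad f y v) H => g H.
apply: (@le_trans _ _ (f (y + t *: v) - f y + e' * (t * `|v|))).
  by move: (f _) (f _) (e' * _) H => u1 u2 u3 H; lra.
rewrite lerD//; first by rewrite lerBlDl.
by rewrite mulrCA ler_pM2l.
Qed.

End pseudo_norms.

Section homogeneous.
Context {R : realType}.
Local Notation plane := 'rV[R]_2.
Implicit Types (f : plane -> R) (y v : plane).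

Lemma der_affine (a b t : R) : is_derive t 1 (fun s : R => a + s * b) b.
Proof.

apply: is_derive_eq (dv_add (dv_cst _ _ _) (dv_mul (is_derive_id _ _) (dv_cst _ _ _))) _.
by rewrite mulr0 !add0r mulr1.
Qed.

(** The factor [c] leaves the degree free: [c = a] is used for degree 1 and [c = 1] for degree 0. *)
Lemma homog_partial f (a c : R) y i : a != 0 -> (forall z, f (a *: z) = c * f z) ->
  C1_at f y -> partial i f (a *: y) = c / a * partial i f y.
Proof.
move=> a0 fa fy.
suff /@derive_val : is_derive (a *: y) (basis_vec i) f (c / a * partial i f y) by [].
apply/is_derive_lineP.
rewrite (_ : (fun t : R => _) = fun t => c * f (y + (t / a) *: basis_vec i)); last first.
  by apply/funext => t; rewrite -fa scalerDr scalerA mulrCA divff// mulr1.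
have c0 : y + ((0 : R) / a) *: (basis_vec i : plane) = y by rewrite mul0r scale0r addr0.
have fc : C1_at f (y + ((0 : R) / a) *: basis_vec i) by rewrite c0.
have := @is_derive_curve R f (fun t => y + (t / a) *: basis_vec i) 0 (a^-1 *: basis_vec i) fc.
move=> /= H; apply: is_derive_eq (dv_mul (dv_cst _ _ c) (H _)) _.
  move=> j; rewrite (_ : (fun t : R => _) = fun t => y 0 j + t * (a^-1 * (basis_vec i : plane) 0 j)); last first.
    by apply/funext => t; rewrite !mxE mulrA.
  by apply: is_derive_eq (der_affine _ _ _) _; rewrite [RHS]mxE.
rewrite c0 mulr0 addr0 -mulrA; congr (_ * _).
by rewrite gradZ grad_basis.
Qed.

End homogeneous.

(** * The Funk function: regularity, and a closed form for F *)

Section funk.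
Context {R : realType}.
Local Notation plane := 'rV[R]_2.
Variables (phi : plane -> R) (x : plane).
Hypotheses (phiN : pseudo_norm phi) (x1 : Omega phi x).
Local Notation P := (funkP phi x).

Let x1' : phi x < 1 := x1.

(* The change of variables [z = y + P(x,y) x] and its inverse. *)
Definition foot (y : plane) : plane := y + P y *: x.

Lemma funkP_spec y : P y = phi (foot y).
Proof.
have [p [pE _]] := funkP_exists_unique y phiN x1.
exact: (@getPex _ [set p | p = phi (y + p *: x)] (ex_intro _ p pE)).
Qed.

Lemma funkP_unique y p : p = phi (y + p *: x) -> P y = p.
Proof.
have [q [_ qU]] := funkP_exists_unique y phiN x1.
by move=> /qU <-; apply/esym/qU/funkP_spec.
Qed.

Definition unfoot (z : plane) : plane := z - phi z *: x.

Lemma funkP_unfoot z : P (unfoot z) = phi z.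
Proof. by apply: funkP_unique; rewrite /unfoot subrK. Qed.

Lemma unfootK z : foot (unfoot z) = z.
Proof. by rewrite /foot funkP_unfoot subrK. Qed.

Lemma footK y : unfoot (foot y) = y.
Proof. by rewrite /unfoot -funkP_spec addrK. Qed.

Lemma unfoot0 : unfoot 0 = 0.
Proof. by rewrite /unfoot (pn00 phiN) scale0r subr0. Qed.

Lemma foot0 : foot 0 = 0. Proof. by rewrite -[in LHS]unfoot0 unfootK. Qed.

Lemma foot_neq0 y : y != 0 -> foot y != 0.
Proof. by apply: contra_neq => y0; rewrite -(footK y) y0 unfoot0. Qed.

Lemma unfoot_neq0 y : y != 0 -> unfoot y != 0.
Proof. by apply: contra_neq => y0; rewrite -(unfootK y) y0 foot0. Qed.

(** Since [phi x < 1], the function [p - phi (y + p *: x)] increases strictly with [p], and [P y] is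
    its zero. *)
Lemma funkP_le y p : phi (y + p *: x) <= p -> P y <= p.
Proof.
move=> le_p; rewrite leNgt; apply/negP => lt_p.
have d0 : 0 <= P y - p by rewrite subr_ge0 ltW.
have := funkP_spec y; rewrite /foot.
have -> : y + P y *: x = (y + p *: x) + (P y - p) *: x.
  by rewrite -addrA -scalerDl subrKC.
have := pnD phiN (y + p *: x) ((P y - p) *: x); rewrite (pnZ phiN x d0).
move: (P y) le_p lt_p d0 => q le_p lt_p d0 + qE; rewrite -qE; have := x1'; nra.
Qed.

(** For subadditivity, [P y1 + P y2] satisfies the hypothesis of [funkP_le] at [y1 + y2]. The
    resulting Lipschitz bound starts the proof of differentiability. *)
Lemma funkP_pseudo_norm : pseudo_norm P.
Proof.
split.
- by move=> y; rewrite funkP_spec pn_ge0.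
- move=> y; split=> [P0|->]; last by rewrite funkP_spec foot0 (pn00 phiN).
  have := funkP_spec y; rewrite P0 /foot P0 scale0r addr0 => /esym.
  by have [_ + _ _] := phiN => /(_ y)[+ _].
- move=> a y a0; apply: funkP_unique.
  by rewrite -scalerA -scalerDr (pnZ phiN _ (ltW a0)) -/(foot y) -funkP_spec.
- move=> y1 y2; apply: funkP_le.
  rewrite scalerDl addrACA; apply: le_trans (pnD phiN _ _) _.
  by rewrite -/(foot y1) -/(foot y2) -!funkP_spec.
Qed.

Lemma footZ (a : R) y : 0 <= a -> foot (a *: y) = a *: foot y.
Proof. by move=> a0; rewrite /foot (pnZ funkP_pseudo_norm)// -scalerA scalerDr. Qed.

Definition slope z := 1 - grad phi z x.

Lemma slope_gt0 z : C1_at phi z -> 0 < slope z.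
Proof. by move=> C1; rewrite subr_gt0 (le_lt_trans (pn_grad_le phiN x C1)). Qed.

(** Implicit differentiation of [P = phi (y + P x)]. The Lipschitz bound on [P] makes the
    displacement [w] of the foot a [O(h)], so the first-order error of [phi] along [w] is [o(h)];
    solving for the increment of [P] divides by the slope. *)
Lemma funkP_derive y v : C1_at phi (foot y) ->
  is_derive y v P (grad phi (foot y) v / slope (foot y)).
Proof.
move=> C1; have D0 := slope_gt0 C1; have [df cf] := C1.
set z := foot y in C1 D0 df cf *; set D := slope z in D0 *.
have [M M0 PM] := pn_lipschitz funkP_pseudo_norm.
(* [K] bounds the norm of [w] divided by that of [h]; the tolerance [e * D / K] below then yields
   exactly [e]. *)
pose K := `|v| + M * `|v| * `|x| + 1.
have K0 : 0 < K by rewrite ltr_wpDl// addr_ge0// !mulr_ge0// ltW.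
suff H : (fun h : R => h^-1 *: ((P \o shift y) (h *: v) - P y)) @ 0^'
    --> (grad phi z v / D : R^o).
  split; first exact: cvgP H.
  exact: cvg_lim H.
apply/cvgrPdist_le => e e0.
have eDK : 0 < e * D / K by rewrite divr_gt0// mulr_gt0.
have /nbhs_ballP[d /= d0 Hd] := C1_increment df cf eDK.
near=> h.
have h0 : h != 0 by near: h; exact: nbhs_dnbhs_neq.
have hd : `|h| < d / K.
  by near: h; apply: dnbhs0_lt; rewrite divr_gt0.
rewrite /= (addrC _ y); set Q := P (y + h *: v) - P y.
pose w := h *: v + Q *: x.
have Qle : `|Q| <= M * (`|h| * `|v|) by rewrite (le_trans (PM _ _))// normrZ.
have wle : `|w| <= `|h| * K.
  rewrite (le_trans (ler_normD _ _))// !normrZ /K mulrDr mulr1 -[leLHS]addr0 lerD//.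
  rewrite mulrDr lerD//; apply: le_trans (ler_wpM2r (normr_ge0 x) Qle) _.
  by rewrite !mulrA (mulrC M).
have zw : foot (y + h *: v) = z + w.
  by rewrite /w /z /foot addrACA -scalerDl /Q subrKC.
have wd : `|w| < d.
  by rewrite (le_lt_trans wle)// -ltr_pdivlMr.
have := Hd w; rewrite -ball_normE /ball_/= sub0r normrN => /(_ wd).
(* By the equation defining [P], the increment of [phi] along [w] is the increment [Q] of [P]. *)
have -> : phi (z + w) - phi z = Q by rewrite /Q !funkP_spec zw.
have -> : Q - grad phi z w = Q * D - h * grad phi z v.
  rewrite /w gradD !gradZ /D /slope.
  by move: (grad phi z v) (grad phi z x) => a b; ring.
move=> H.
have -> : grad phi z v / D - h^-1 *: Q = - ((Q * D - h * grad phi z v) / (h * D)).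
  have D1 : D != 0 by rewrite gt_eqF.
  rewrite -[_ *: _]/(h^-1 * Q); move: (grad phi z v) => a; field.
  by rewrite D1 h0.
rewrite normrN normrM normfV normrM (gtr0_norm D0) ler_pdivrMr; last first.
  by rewrite mulr_gt0// normr_gt0.
apply: le_trans H _.
apply: le_trans (ler_wpM2l (ltW eDK) wle) _.
have K1 : K != 0 by rewrite gt_eqF.
rewrite le_eqVlt; apply/orP; left; apply/eqP.
by move: (`|h|) (K) (D) K1 => a b c b0; field.
Unshelve. all: by end_near. Qed.

Lemma funkP_partial y i : C1_at phi (foot y) ->
  partial i P y = partial i phi (foot y) / slope (foot y).
Proof.
move=> C1; rewrite -[in RHS]grad_basis.
by have /@derive_val := funkP_derive (basis_vec i) C1.
Qed.

Hypothesis phi_smooth : smooth_on [set y | y != 0] phi.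
Local Notation U0 := [set y : plane | y != 0].

Lemma open_neq0 : open U0.
Proof.
rewrite (_ : U0 = ~` [set 0]).
  by rewrite openC; exact/accessible_closed_set1/hausdorff_accessible/norm_hausdorff.
by apply/seteqP; split => y /= /eqP.
Qed.

Lemma smooth_C1 z : z != 0 -> C1_at phi z.
Proof.
move=> z0; have /smooth_onP/(_ 1%N) phi1 := phi_smooth.
exact: Ck_C1 open_neq0 phi1 z0.
Qed.

Lemma slope_Ck n : Ck n U0 slope.
Proof.
have /smooth_onP phiC := phi_smooth.
apply: Ck_add; [exact: open_neq0|exact: Ck_cst open_neq0|].
apply: Ck_opp; first exact: open_neq0.
by apply: Ck_add; first exact: open_neq0; apply: Ck_mul;
  try exact: open_neq0; try exact: (Ck_cst _ _ open_neq0); exact: Ck_partial (phiC n.+1).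
Qed.

Lemma foot_Ck n i : Ck n U0 P -> Ck n U0 (fun y => foot y 0 i).
Proof.
move=> PC; rewrite (_ : (fun y => _) = fun y : plane => y 0 i + P y * x 0 i); last first.
  by apply/funext => y; rewrite !mxE.
have o := open_neq0.
by apply: Ck_add => //; [exact: Ck_coord|apply: Ck_mul => //; exact: Ck_cst].
Qed.

(* Bootstrap: the derivatives of [P] are smooth functions of [P] itself. *)
Lemma funkP_Ck n : Ck n U0 P.
Proof.
have o := open_neq0; have /smooth_onP phiC := phi_smooth.
elim: n => [|n IH].
  by split => // z _; exact: pn_continuous funkP_pseudo_norm z.
have fC i := foot_Ck i IH.
apply: (@Ck_intro _ _ _ _ (fun i z => partial i phi (foot z) * (slope (foot z))^-1)) => //.
  move=> z i /foot_neq0/smooth_C1 C1.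
  by rewrite -grad_basis; exact: funkP_derive.
move=> i; apply: Ck_mul => //.
  apply: (Ck_comp o o _ fC) => [z|]; first exact: foot_neq0.
  exact: Ck_partial (phiC n.+1).
apply: Ck_inv => // [z /foot_neq0/smooth_C1/slope_gt0|]; first by move=> /gt_eqF ->.
apply: (Ck_comp o o _ fC) => [z|]; first exact: foot_neq0.
exact: slope_Ck.
Qed.

Variable psi : plane -> R.
Hypotheses (psiN : pseudo_norm psi) (psi_smooth : smooth_on [set y | y != 0] psi).
Local Notation F := (metricF psi phi x).

Lemma metricF_smooth : smooth_on U0 F.
Proof.
have o := open_neq0; apply/smooth_onP => n; have /smooth_onP psiC := psi_smooth.
have PC := funkP_Ck n.+1.
rewrite (_ : F = fun y => psi (foot y) *
    (1 + (x 0 0 * partial 0 P y + x 0 1 * partial 1 P y))); last first.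
  by apply/funext => y; rewrite /metricF sum_ord2.
apply: Ck_mul => //.
  apply: (Ck_comp o o _ _ (psiC n)) => [z|i]; first exact: foot_neq0.
  by apply: foot_Ck; exact: funkP_Ck.
apply: Ck_add => //; first exact: Ck_cst.
by apply: Ck_add => //; apply: Ck_mul => //; try exact: Ck_cst; exact: Ck_partial PC.
Qed.

(** With [D] the slope at the foot, the second factor of [F] is [1 + dphi(x) / D], and this is
    [1 / D] because [D = 1 - dphi(x)]. *)
Lemma metricFE y : y != 0 -> F y = psi (foot y) / slope (foot y).
Proof.
move=> /foot_neq0/smooth_C1 C1; have D0 := slope_gt0 C1.
rewrite /metricF sum_ord2 !funkP_partial//; congr (_ * _).
have s0 : slope (foot y) != 0 by rewrite gt_eqF.
have sE : slope (foot y) + (x 0 0 * partial 0 phi (foot y) + x 0 1 * partial 1 phi (foot y)) = 1.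
  by rewrite /slope /grad subrK.
move: (slope _) (partial 0 _ _) (partial 1 _ _) (x 0 0) (x 0 1) s0 sE => s a b c d s0 sE.
have -> : 1 + (c * (a / s) + d * (b / s)) = (s + (c * a + d * b)) / s by field.
by rewrite sE div1r.
Qed.

Lemma metricF_unfoot z : z != 0 -> F (unfoot z) = psi z / slope z.
Proof. by move=> z0; rewrite metricFE ?unfoot_neq0// unfootK. Qed.

Lemma metricF0 : F 0 = 0.
Proof. by rewrite /metricF -/(foot 0) foot0 (pn00 psiN) mul0r. Qed.

Lemma metricF_gt0 y : y != 0 -> 0 < F y.
Proof.
move=> y0; rewrite metricFE//; apply: divr_gt0; first exact/(pn_gt0 psiN)/foot_neq0.
exact/slope_gt0/smooth_C1/foot_neq0.
Qed.

Lemma slopeZ (a : R) z : 0 < a -> z != 0 -> slope (a *: z) = slope z.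
Proof.
move=> a0 z0; have a1 : a != 0 by rewrite gt_eqF.
have H i : partial i phi (a *: z) = partial i phi z.
  rewrite (homog_partial i a1 (c := a)) ?divff ?mul1r//; last exact: smooth_C1.
  by move=> y; rewrite pnZ// ltW.
by rewrite /slope /grad !H.
Qed.

Lemma metricFZ (a : R) y : 0 < a -> F (a *: y) = a * F y.
Proof.
move=> a0; have [->|y0] := eqVneq y 0; first by rewrite scaler0 metricF0 mulr0.
have ay : a *: y != 0 by rewrite scaler_eq0 negb_or gt_eqF.
rewrite !metricFE// footZ ?ltW// slopeZ ?foot_neq0// pnZ ?(ltW a0)//.
by rewrite mulrA.
Qed.

End funk.

Lemma partial_val (R : realType) (f : 'rV[R]_2 -> R) (y : 'rV[R]_2) i d :
  is_derive y (basis_vec i) f d -> partial i f y = d.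
Proof. by move/@derive_val. Qed.

(** * The Hessian of a homogeneous function *)

Section homogeneous1.
Context {R : realType}.
Local Notation plane := 'rV[R]_2.
Local Notation U0 := [set y : plane | y != 0].
Implicit Types (y z u v : plane).

(* Euler's identity; [p + a * q] covers the degrees 1 ([p = 0]) and 0 ([q = 0]). *)
Lemma radial_derive (f : plane -> R) y (p q : R) : C1_at f y ->
  (forall a : R, 0 < a -> f (a *: y) = p + a * q) -> grad f y y = q.
Proof.
move=> C1 H; have /is_derive_lineP/@derive_val <- := C1_derive y C1.
have : is_derive (0 : R) 1 (fun t : R => f (y + t *: y)) q; last by move/@derive_val.
apply: near_eq_is_derive (der_affine (p + q) q 0).
near=> t; have t1 : 0 < 1 + t.
  have : `|t| < 1.
    near: t; apply/nbhs_ballP; exists 1 => //= t.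
    by rewrite -ball_normE /= sub0r normrN.
  by rewrite ltr_norml => /andP[]; lra.
have -> : y + (t : R) *: y = (1 + t) *: y by rewrite scalerDl scale1r.
by rewrite (H _ t1); ring.
Unshelve. all: by end_near. Qed.

Definition det2 (u v : plane) : R := u 0 0 * v 0 1 - u 0 1 * v 0 0.
Definition norm2 (u : plane) : R := u 0 0 ^+ 2 + u 0 1 ^+ 2.

Lemma norm2_gt0 u : u != 0 -> 0 < norm2 u.
Proof.
move=> u0; rewrite lt_neqAle addr_ge0 ?sqr_ge0// andbT eq_sym.
apply: contra_neq u0 => /eqP; rewrite paddr_eq0 ?sqr_ge0// !sqrf_eq0.
by move=> /andP[/eqP h0 /eqP h1]; apply: plane_eqP; rewrite ?h0 ?h1 !mxE.
Qed.

Lemma det2_eq0 u v : u != 0 -> det2 u v = 0 -> exists k : R, v = k *: u.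
Proof.
move=> u0 dv; have n0 : norm2 u != 0 by rewrite gt_eqF ?norm2_gt0.
exists ((u 0 0 * v 0 0 + u 0 1 * v 0 1) / norm2 u).
apply: (scalerI n0); rewrite scalerA mulrCA divff// mulr1.
have alg (a b c d : R) : a * d - b * c = 0 ->
    (a ^+ 2 + b ^+ 2) * c = (a * c + b * d) * a /\
    (a ^+ 2 + b ^+ 2) * d = (a * c + b * d) * b.
  move=> e; split; apply: subr0_eq.
    by transitivity (- b * (a * d - b * c)); [ring|rewrite e mulr0].
  by transitivity (a * (a * d - b * c)); [ring|rewrite e mulr0].
have [e0 e1] := alg _ _ _ _ dv.
by apply: plane_eqP; rewrite !mxE.
Qed.

Variable F : plane -> R.
Hypothesis F_smooth : smooth_on U0 F.
Hypothesis F_homog : forall (a : R) y, 0 < a -> F (a *: y) = a * F y.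

Let o : open U0 := open_neq0.

Lemma smooth_partial_C1 y i : y != 0 -> C1_at (partial i F) y.
Proof.
have /smooth_onP/(_ 2%N) F2 := F_smooth.
move=> y0; exact: Ck_C1 o (Ck_partial i F2) y0.
Qed.

Lemma euler1 y : y != 0 -> grad F y y = F y.
Proof.
move=> y0; apply: (@radial_derive _ _ 0); first exact: smooth_C1.
by move=> a a0; rewrite F_homog// add0r.
Qed.

Lemma partial_homog0 y i (a : R) : y != 0 -> 0 < a -> partial i F (a *: y) = partial i F y.
Proof.
move=> y0 a0; have a1 : a != 0 by rewrite gt_eqF.
rewrite (homog_partial i a1 (c := a)) ?divff ?mul1r//; last exact: smooth_C1.
by move=> z; rewrite F_homog.
Qed.

Lemma euler2 y i : y != 0 -> grad (partial i F) y y = 0.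
Proof.
move=> y0; apply: (@radial_derive _ _ (partial i F y)); first exact: smooth_partial_C1.
by move=> a a0; rewrite partial_homog0// mulr0 addr0.
Qed.

(* The derivative of Euler's identity. Together with [euler2], it makes Schwarz's
   theorem on mixed partial derivatives unnecessary. *)
Lemma euler2' y i : y != 0 ->
  y 0 0 * partial i (partial 0 F) y + y 0 1 * partial i (partial 1 F) y = 0.
Proof.
move=> y0; pose e : plane := basis_vec i.
have D j : is_derive y e (partial j F) (partial i (partial j F) y).
  by rewrite -grad_basis; exact: C1_derive (smooth_partial_C1 _ y0).
have D1 : is_derive y e F (partial i F y).
  by rewrite -grad_basis; apply: C1_derive; exact: smooth_C1.
have D2 := dv_add (dv_mul (coord_derive y e 0) (D 0)) (dv_mul (coord_derive y e 1) (D 1)).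
have D3 : is_derive y e F _ := near_eq_is_derive_on o y0 euler1 D2.
have := partial_val D3; rewrite -(grad_basis F y i) /grad -/e.
move: (partial i _ _) (partial i _ _) (partial 0 F y) (partial 1 F y) => h0 h1 f0 f1.
move: (e 0 0) (e 0 1) (y 0 0) (y 0 1) => a b c d; lra.
Qed.

(* The [lambda] with Hessian [lambda J J^T], read off the trace. *)
Definition curvature y := (partial 0 (partial 0 F) y + partial 1 (partial 1 F) y) / norm2 y.

(** By [euler2] and [euler2'] the rows and columns of the Hessian are all orthogonal to [y]. Such a
    matrix is a multiple of [J J^T], with [J] the vector [y] turned by a right angle, and its trace
    gives the factor. *)
Lemma partial2E y : y != 0 ->
  [/\ partial 0 (partial 0 F) y = curvature y * y 0 1 ^+ 2,
      partial 1 (partial 0 F) y = - curvature y * (y 0 0 * y 0 1),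
      partial 0 (partial 1 F) y = - curvature y * (y 0 0 * y 0 1) &
      partial 1 (partial 1 F) y = curvature y * y 0 0 ^+ 2].
Proof.
move=> y0; have n0 := norm2_gt0 y0; rewrite /curvature.
have alg (A B C D u v : R) : 0 < u ^+ 2 + v ^+ 2 ->
    u * A + v * B = 0 -> u * C + v * D = 0 -> u * A + v * C = 0 -> u * B + v * D = 0 ->
    [/\ A = (A + D) / (u ^+ 2 + v ^+ 2) * v ^+ 2,
        B = - ((A + D) / (u ^+ 2 + v ^+ 2)) * (u * v),
        C = - ((A + D) / (u ^+ 2 + v ^+ 2)) * (u * v) &
        D = (A + D) / (u ^+ 2 + v ^+ 2) * u ^+ 2].
  move=> m0 a0 a1 b0 b1.
have n1 : u ^+ 2 + v ^+ 2 != 0 by rewrite gt_eqF.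
have key (X Y : R) : X * (u ^+ 2 + v ^+ 2) - Y = 0 -> X = Y / (u ^+ 2 + v ^+ 2).
  by move=> /subr0_eq <-; rewrite mulfK.
rewrite mulNr ![_ / _ * _]mulrAC -!mulNr; split; apply: key.
- transitivity (u * (u * A + v * B) - v * (u * B + v * D)); first by ring.
  by rewrite a0 b1; ring.
- transitivity (u * (u * B + v * D) + v * (u * A + v * B)); first by ring.
  by rewrite a0 b1; ring.
- transitivity (u * (u * C + v * D) + v * (u * A + v * C)); first by ring.
  by rewrite a1 b0; ring.
- transitivity (v * (u * B + v * D) - u * (u * A + v * B)); first by ring.
  by rewrite a0 b1; ring.
apply: alg; first exact: norm2_gt0.
- exact: euler2.
- exact: euler2.
- exact: euler2'.
- exact: euler2'.
Qed.

Lemma grad2E y v w : y != 0 ->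
  v 0 0 * grad (partial 0 F) y w + v 0 1 * grad (partial 1 F) y w =
  curvature y * (det2 y v * det2 y w).
Proof.
move=> y0; rewrite /grad /det2; have [-> -> -> ->] := partial2E y0.
by move: (curvature y) (y 0 0) (y 0 1) (v 0 0) (v 0 1) (w 0 0) (w 0 1) => *; ring.
Qed.

Lemma hessian_sqrE y i j : y != 0 -> hessian (fun z => F z ^+ 2) y i j =
  2 * (partial i F y * partial j F y + F y * partial j (partial i F) y).
Proof.
move=> y0; rewrite mxE.
have D1 z k : z != 0 -> is_derive z (basis_vec k : plane) F (partial k F z).
  by move=> z0; rewrite -[in X in is_derive _ _ _ X]grad_basis; apply: C1_derive; exact: smooth_C1.
have P1 z k : z != 0 -> partial k (fun z => F z ^+ 2) z = 2 * (F z * partial k F z).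
  move=> z0; rewrite (_ : (fun z => F z ^+ 2) = fun z => F z * F z).
    by rewrite (partial_val (dv_mul (D1 z k z0) (D1 z k z0))); ring.
  by apply/funext => u; rewrite expr2.
have D2 : is_derive y (basis_vec j : plane) (partial i F) (partial j (partial i F) y).
  by rewrite -[in X in is_derive _ _ _ X]grad_basis; exact: C1_derive (smooth_partial_C1 _ y0).
have D3 := dv_mul (dv_cst y (basis_vec j : plane) (2 : R)) (dv_mul (D1 y j y0) D2).
have D4 := near_eq_is_derive_on o y0 (fun z (z0 : U0 z) => esym (P1 z i z0)) D3.
rewrite (partial_val D4).
by move: (F y) (partial i F y) (partial j F y) (partial j _ y) => *; ring.
Qed.

Lemma hessian_sqr_form y v : y != 0 ->
  (v *m hessian (fun z => F z ^+ 2) y *m v^T) 0 0 =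
  2 * (grad F y v ^+ 2 + F y * curvature y * det2 y v ^+ 2).
Proof.
move=> y0; rewrite !mxE sum_ord2 !mxE !sum_ord2 !hessian_sqrE//.
have [-> -> -> ->] := partial2E y0; rewrite /grad /det2.
by move: (curvature y) (F y) (partial 0 F y) (partial 1 F y) (y 0 0) (y 0 1) (v 0 0) (v 0 1) => *; ring.
Qed.

Lemma det_mx22 (A : 'M[R]_2) : \det A = A 0 0 * A 1 1 - A 0 1 * A 1 0.
Proof.
rewrite (expand_det_row _ 0) sum_ord2 /cofactor !det_mx11 !mxE.
have -> : lift 0 0 = 1 :> 'I_2 by exact: val_inj.
have -> : lift 1 0 = 0 :> 'I_2 by exact: val_inj.
by rewrite /= expr0 expr1 mul1r mulN1r mulrN.
Qed.

(** The matrix is [2 (g g^T + F lambda J J^T)] with [g] the gradient of [F], so its determinant is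
    [4 F lambda det(g, J)^2]. By Euler's identity [det(g, J)] is [F] up to sign. *)
Lemma hessian_sqr_unit y : y != 0 ->
  (hessian (fun z => F z ^+ 2) y \in unitmx) = (F y ^+ 3 * curvature y != 0).
Proof.
move=> y0; rewrite unitmxE det_mx22 !hessian_sqrE// unitfE.
have [-> -> -> ->] := partial2E y0; rewrite -[in RHS](euler1 y0) /grad.
rewrite -[in LHS](euler1 y0) /grad.
rewrite [X in (X != 0) = _](_ : _ = 4 * ((y 0 0 * partial 0 F y + y 0 1 * partial 1 F y) ^+ 3 * curvature y)).
  by rewrite mulf_eq0 pnatr_eq0.
by move: (curvature y) (partial 0 F y) (partial 1 F y) (y 0 0) (y 0 1) => *; ring.
Qed.

Hypothesis F_gt0 : forall y, y != 0 -> 0 < F y.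

Lemma hessian_sqr_degenerate y : y != 0 ->
  (hessian (fun z => F z ^+ 2) y \notin unitmx) = (curvature y == 0).
Proof.
by move=> y0; rewrite hessian_sqr_unit// negbK mulf_eq0 expf_eq0/= gt_eqF ?F_gt0.
Qed.

Definition perp y : plane := \row_i (if i == 0 then - y 0 1 else y 0 0).

Lemma det2_perp y : det2 y (perp y) = norm2 y.
Proof. by rewrite /det2 /norm2 /perp !mxE/= mulrN opprK -!expr2. Qed.

(** The quadratic form of [hessian_sqr_form] is a sum of a square of [dF(v)] and a multiple of
    [det2 y v ^+ 2]; these two linear forms have no common zero except [v = 0], as [dF(y) = F y] is
    positive. *)
Lemma hessian_sqr_pos_def y : y != 0 ->
  pos_def (hessian (fun z => F z ^+ 2) y) <-> 0 < curvature y.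
Proof.
move=> y0; have Fy := F_gt0 y0; have n0 := norm2_gt0 y0; split.
  (* A vector in the kernel of [dF], independent of [y]: on it only the curvature term remains. *)
  pose w := F y *: perp y - grad F y (perp y) *: y.
  have gw : grad F y w = 0.
    by rewrite /w -scaleNr gradD !gradZ euler1// mulrC mulNr subrr.
  have dw : det2 y w = F y * norm2 y.
    rewrite -det2_perp /w /det2 !mxE.
    by move: (grad _ _ _) (F y) (y 0 0) (y 0 1) => *; ring.
  have w0 : w != 0.
    apply/eqP => w0; move: dw; rewrite w0 /det2 !mxE !mulr0 subrr => /esym/eqP.
    by rewrite mulf_eq0 !gt_eqF.
  move=> /(_ w w0); rewrite hessian_sqr_form// gw dw expr0n add0r.
  rewrite pmulr_rgt0// pmulr_lgt0; last by rewrite exprn_gt0 ?mulr_gt0.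
  by rewrite pmulr_rgt0.
move=> c0 v v0; rewrite hessian_sqr_form// pmulr_rgt0//.
have Fc : 0 < F y * curvature y by rewrite mulr_gt0.
have [d0|d0] := eqVneq (det2 y v) 0; last first.
  by rewrite ltr_wpDl ?sqr_ge0// mulr_gt0// exprn_even_gt0.
have [k vE] := det2_eq0 y0 d0; rewrite d0 expr0n mulr0 addr0 vE gradZ euler1//.
rewrite exprn_even_gt0//= mulf_neq0 ?(gt_eqF Fy)//.
by apply: contra_neq v0 => k0; rewrite vE k0 scale0r.
Qed.

End homogeneous1.

(** * Positive curvature and the strict triangle inequality *)

Section strict_convexity.
Context {R : realType}.
Local Notation plane := 'rV[R]_2.
Local Notation U0 := [set y : plane | y != 0].
Implicit Types (y z u v : plane).
Variable F : plane -> R.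
Hypothesis F_smooth : smooth_on U0 F.
Hypothesis F_homog : forall (a : R) y, 0 < a -> F (a *: y) = a * F y.
Hypothesis F_gt0 : forall y, y != 0 -> 0 < F y.
Hypothesis F0 : F 0 = 0.

Lemma line_derive (f : plane -> R) y v (t : R) : C1_at f (y + t *: v) ->
  is_derive t 1 (fun s : R => f (y + s *: v)) (grad f (y + t *: v) v).
Proof.
move=> /(C1_derive v) H; have [d <-] := H.
exact: is_derive_line.
Qed.

Lemma det2_neq0 u v : det2 u v != 0 -> u != 0.
Proof. by apply: contraNneq => ->; rewrite /det2 !mxE !mul0r subrr. Qed.

Lemma det2_line y v (t : R) : det2 (y + t *: v) v = det2 y v.
Proof.
rewrite /det2 !mxE; move: (y 0 0) (y 0 1) (v 0 0) (v 0 1) => *; ring.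
Qed.

(** The line through [y1] and [y2] avoids the origin, and the second derivative of [F] along it is
    the curvature times a nonzero square. So [F] at the midpoint is below the mean of its end
    values; homogeneity turns the midpoint into the sum. *)
Lemma strict_triangle y1 y2 : (forall y, y != 0 -> 0 < curvature F y) ->
  det2 y1 y2 != 0 -> F (y1 + y2) < F y1 + F y2.
Proof.
move=> c0 d0; pose v := y2 - y1.
have dv0 : det2 y1 v != 0.
  rewrite [X in X != 0](_ : _ = det2 y1 y2)// /det2 !mxE.
  by move: (y1 0 0) (y1 0 1) (y2 0 0) (y2 0 1) => *; ring.
have line0 t : y1 + t *: v != 0.
  by apply: (@det2_neq0 _ v); rewrite det2_line.
pose g (t : R) := F (y1 + t *: v); pose g1 (t : R) := grad F (y1 + t *: v) v.
pose g2 (t : R) := curvature F (y1 + t *: v) * (det2 (y1 + t *: v) v * det2 (y1 + t *: v) v).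
have dg (t : R) : is_derive t 1 g (g1 t).
  by apply: line_derive; exact: smooth_C1.
have dg1 (t : R) : is_derive t 1 g1 (g2 t).
  have dp i : is_derive t 1 (fun s : R => partial i F (y1 + s *: v))
    (grad (partial i F) (y1 + t *: v) v).
    by apply: line_derive; exact: smooth_partial_C1.
  rewrite /g2 -grad2E//.
  apply: is_derive_eq (dv_add (dv_mul (dv_cst _ _ (v 0 0)) (dp 0)) (dv_mul (dv_cst _ _ (v 0 1)) (dp 1))) _.
  have alg (a b c d e f : R) : a * b + c * 0 + (d * e + f * 0) = a * b + d * e by ring.
  exact: alg.
have g2_gt0 t : 0 < g2 t.
  by rewrite /g2 mulr_gt0 ?c0// det2_line -expr2 exprn_even_gt0.
have mvt (f df : R -> R) (a b : R) : (forall t : R, is_derive t 1 f (df t)) -> a < b ->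
    exists2 c, a < c < b & f b - f a = df c * (b - a).
  move=> fd ab; have cf : {within `[a, b], continuous f}.
    by apply: derivable_within_continuous => t _; have [] := fd t.
  have [c cab E] := MVT ab (fun (t : R) _ => fd t) cf.
  by exists c => //; move: cab; rewrite in_itv.
have h0 : (0 : R) < 1 / 2 by rewrite divr_gt0.
have h1 : (1 / 2 : R) < 1 by rewrite ltr_pdivrMr// mul1r ltr1n.
have [s /andP[s0 s1] E1] := mvt _ _ _ _ dg h0.
have [t /andP[t0 t1] E2] := mvt _ _ _ _ dg h1.
have st : s < t by exact: lt_trans s1 t0.
have [r _ E3] := mvt _ _ _ _ dg1 st.
have lt_st : g1 s < g1 t.
  by rewrite -subr_gt0 E3 mulr_gt0 ?g2_gt0 ?subr_gt0.
have m2 : F (y1 + y2) = 2 * g (1 / 2).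
  have -> : y1 + y2 = (2 : R) *: (y1 + ((1 : R) / 2) *: v).
    by apply/rowP => i; rewrite /v !mxE; move: (y1 0 i) (y2 0 i) => *; field.
  by rewrite F_homog.
have e0 : g 0 = F y1 by rewrite /g scale0r addr0.
have e1 : g 1 = F y2 by rewrite /g scale1r subrKC.
rewrite m2; move: E1 E2; rewrite e0 e1.
move: (g _) (g1 s) (g1 t) lt_st (F y1) (F y2) => a b c bc f1 f2; lra.
Qed.

(** When [y2 = k *: y1], equality holds for [k >= 0]. For [k < 0] the sum is a shorter multiple of
    [y1] or of [- y1], according to the sign of [1 + k], and the inequality is strict. *)
Lemma triangle_cases y1 y2 : (forall y, y != 0 -> 0 < curvature F y) ->
  F (y1 + y2) < F y1 + F y2 \/
  (F (y1 + y2) = F y1 + F y2 /\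
   exists a1 a2 : R, [/\ 0 <= a1, 0 <= a2, 0 < a1 + a2 & a1 *: y1 = a2 *: y2]).
Proof.
move=> c0; have Fge y : 0 <= F y.
  by have [->|/F_gt0/ltW//] := eqVneq y 0; rewrite F0.
have [->|y10] := eqVneq y1 0.
  right; rewrite add0r F0 add0r; split => //.
  by exists 1, 0; rewrite ler01 lexx addr0 ltr01 scaler0 scale0r.
have [d0|/(strict_triangle c0)] := eqVneq (det2 y1 y2) 0; last by left.
have [k ->] := det2_eq0 y10 d0.
have [k0|k0] := leP 0 k.
  right; split; last first.
    by exists k, 1; rewrite k0 ler01 ltr_wpDl// scale1r.
  have [->|k1] := eqVneq k 0; first by rewrite scale0r F0 !addr0.
  rewrite F_homog; last by rewrite lt_neqAle eq_sym k1.
  have -> : y1 + k *: y1 = (1 + k) *: y1 by rewrite scalerDl scale1r.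
  by rewrite F_homog ?mulrDl ?mul1r// ltr_wpDr.
left; have [k1|k1|k1] := ltgtP (1 + k) 0.
- have -> : y1 + k *: y1 = (- (1 + k)) *: (- y1).
    by rewrite scaleNr scalerN opprK scalerDl scale1r.
  have -> : k *: y1 = (- k) *: (- y1) by rewrite scaleNr scalerN opprK.
  rewrite !F_homog ?oppr_gt0//; have := F_gt0 y10; have := Fge (- y1).
  by move: (F _) (F _) => a b; nra.
- have -> : y1 + k *: y1 = (1 + k) *: y1 by rewrite scalerDl scale1r.
  rewrite F_homog//; have := F_gt0 y10; have := Fge (k *: y1).
  by move: (F _) (F _) => a b; nra.
- have -> : y1 + k *: y1 = (1 + k) *: y1 by rewrite scalerDl scale1r.
  by rewrite k1 scale0r F0 ltr_wpDr ?F_gt0.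
Qed.

Lemma Minkowski_normE :
  Minkowski_norm F <-> forall y, y != 0 -> 0 < curvature F y.
Proof.
split=> [[_ H] y y0|c0].
  by apply/(hessian_sqr_pos_def F_smooth F_homog F_gt0) => //; exact: H.
split; last first.
  by move=> y y0; apply/(hessian_sqr_pos_def F_smooth F_homog F_gt0) => //; exact: c0.
split=> //.
- split=> [y|y|a y|y1 y2].
  + by have [->|/F_gt0/ltW//] := eqVneq y 0; rewrite F0.
  + split=> [|->//] Fy; apply/eqP; rewrite -[_ == _]negbK; apply/negP => /F_gt0.
    by rewrite Fy ltxx.
  + exact: F_homog.
  + by have [/ltW//|[-> _]] := triangle_cases y1 y2 c0.
- by move=> y1 y2 E; have [|[_]//] := triangle_cases y1 y2 c0; rewrite E ltxx.
Qed.

End strict_convexity.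

(** * The curvature of F as a quadratic form in x *)

Section curvature_formula.
Context {R : realType}.
Local Notation plane := 'rV[R]_2.
Local Notation U0 := [set y : plane | y != 0].
Implicit Types (x y z u v : plane).

(* The n-th derivative of [s |-> f (z + s *: v)] at 0. *)
Fixpoint dirn n (f : plane -> R) v z : R :=
  if n is m.+1 then v 0 0 * dirn m (partial 0 f) v z + v 0 1 * dirn m (partial 1 f) v z
  else f z.

Lemma dirn_derive n (f : plane -> R) y v (t : R) : Ck n.+1 U0 f -> y + t *: v != 0 ->
  is_derive t 1 (fun s : R => dirn n f v (y + s *: v)) (dirn n.+1 f v (y + t *: v)).
Proof.
move=> + y0; elim: n f => [|n IH] f fC.
  by apply: line_derive; exact: Ck_C1 open_neq0 fC y0.
have D i := IH _ (Ck_partial i fC).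
apply: is_derive_eq (dv_add (dv_mul (dv_cst _ _ (v 0 0)) (D 0)) (dv_mul (dv_cst _ _ (v 0 1)) (D 1))) _.
have alg (a c d e h k : R) : a * c + d * 0 + (e * h + k * 0) = a * c + e * h by ring.
exact: alg.
Qed.

Lemma is_derive_unique (f : R -> R) (t a b : R) :
  is_derive t 1 f a -> is_derive t 1 f b -> a = b.
Proof. by move=> /@derive_val <- /@derive_val. Qed.

Variables (psi phi : plane -> R).

(* The coefficient [b] in [x = a *: z + b *: perp z]. *)
Definition cone_coord z x := det2 z x / norm2 z.

(** The form [A D^2 + B D b + C b^2], where [A], [B], [C] depend on [z] only, and [D], [b] are
    affine in [x]. *)
Definition cone_form z x : R :=
  let v := perp z in let D := slope phi x z in let b := cone_coord z x in
  dirn 2 psi v z * D ^+ 2 +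
  b * D * (3 * dirn 1 psi v z * dirn 2 phi v z + psi z * dirn 3 phi v z) +
  3 * psi z * dirn 2 phi v z ^+ 2 * b ^+ 2.

Hypotheses (phiN : pseudo_norm phi) (phiS : smooth_on U0 phi).
Hypotheses (psiN : pseudo_norm psi) (psiS : smooth_on U0 psi).

Let phiH (a : R) y : 0 < a -> phi (a *: y) = a * phi y.
Proof. by have [_ _ H _] := phiN; exact: H. Qed.

Variable x : plane.
Hypothesis x1 : Omega phi x.
Local Notation F := (metricF psi phi x).

(** Along [c(t) = unfoot (z + t v)] one has [F(c) = f], where [f = psi / D]. Differentiating twice
    gives [lambda det(c, c')^2 + dF(c'') = f''] with [c'' = - phi'' x]; it remains to express
    [dF(x)] and [det(c, c')] at [t = 0]. *)
Lemma curvature_metricF z : z != 0 ->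
  curvature F (unfoot phi x z) * norm2 z ^+ 2 * slope phi x z ^+ 5 = cone_form z x.
Proof.
move=> z0; have o : open U0 := open_neq0.
have FS : smooth_on U0 F by exact: (metricF_smooth phiN x1 phiS psiS).
have FH (a : R) y : 0 < a -> F (a *: y) = a * F y by exact: (metricFZ phiN x1 phiS psiN).
have [v vE] : exists v, v = perp z by exists (perp z).
pose b := cone_coord z x.
pose a := (z 0 0 * x 0 0 + z 0 1 * x 0 1) / norm2 z.
have n0 : norm2 z != 0 by rewrite gt_eqF ?norm2_gt0.
have v0E : v 0 0 = - z 0 1 by rewrite vE mxE.
have v1E : v 0 1 = z 0 0 by rewrite vE mxE.
have xE : x = a *: z + b *: v.
  have alg (c d e f : R) : c ^+ 2 + d ^+ 2 != 0 ->
      e = (c * e + d * f) / (c ^+ 2 + d ^+ 2) * c + (c * f - d * e) / (c ^+ 2 + d ^+ 2) * - d /\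
      f = (c * e + d * f) / (c ^+ 2 + d ^+ 2) * d + (c * f - d * e) / (c ^+ 2 + d ^+ 2) * c.
    by move=> cd; split; field.
  have [e0 e1] := alg _ _ (x 0 0) (x 0 1) n0.
  by apply: plane_eqP; rewrite 2!mxE [(b *: v) _ _]mxE ?v0E ?v1E.
have zt0 (t : R) : z + t *: v != 0.
  by apply: (@det2_neq0 _ _ v); rewrite det2_line vE det2_perp.
pose p (t : R) := phi (z + t *: v); pose p1 (t : R) := dirn 1 phi v (z + t *: v).
pose p2 (t : R) := dirn 2 phi v (z + t *: v).
pose p3 (t : R) := dirn 3 phi v (z + t *: v).
pose h (t : R) := psi (z + t *: v); pose h1 (t : R) := dirn 1 psi v (z + t *: v).
pose h2 (t : R) := dirn 2 psi v (z + t *: v).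
have phiC := (smooth_onP _ _).1 phiS; have psiC := (smooth_onP _ _).1 psiS.
have dp (t : R) : is_derive t 1 p (p1 t) by exact: (dirn_derive (phiC 1%N) (zt0 t)).
have dp1 (t : R) : is_derive t 1 p1 (p2 t) by exact: (dirn_derive (phiC 2%N) (zt0 t)).
have dp2 (t : R) : is_derive t 1 p2 (p3 t) by exact: (dirn_derive (phiC 3%N) (zt0 t)).
have dh (t : R) : is_derive t 1 h (h1 t) by exact: (dirn_derive (psiC 1%N) (zt0 t)).
have dh1 (t : R) : is_derive t 1 h1 (h2 t) by exact: (dirn_derive (psiC 2%N) (zt0 t)).
(* [a] and [B t] are the coordinates of [x] in the moving basis [z + t *: v], [v]. *)
pose B (t : R) := b + t * - a.
have dB (t : R) : is_derive t 1 B (- a) by exact: der_affine.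
pose D (t : R) := 1 + - (a * p t + B t * p1 t).
have slopeE (t : R) : slope phi x (z + t *: v) = D t.
  rewrite /slope; congr (_ - _).
  have -> : x = a *: (z + t *: v) + B t *: v.
    rewrite [LHS]xE scalerDr -addrA; congr (_ + _).
    by rewrite scalerA -scalerDl; congr (_ *: _); rewrite /B; ring.
  by rewrite gradD !gradZ (euler1 phiS phiH).
have D_gt0 t : 0 < D t by rewrite -slopeE; apply: (slope_gt0 phiN x1); exact: (smooth_C1 phiS (zt0 t)).
have D0 t : D t != 0 by rewrite gt_eqF.
(* The first derivatives of [phi] cancel, since [B] has derivative [- a]. *)
have dD (t : R) : is_derive t 1 D (- (B t * p2 t)).
  apply: is_derive_eq (dv_add (dv_cst _ _ _) (dv_opp
    (dv_add (dv_mul (dv_cst _ _ a) (dp t)) (dv_mul (dB t) (dp1 t))))) _.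
  by move: (B t) (p t) (p1 t) (p2 t) => *; ring.
pose f (t : R) := h t * (D t)^-1.
pose f1 (t : R) := h1 t * (D t)^-1 + h t * (B t * p2 t) * ((D t)^-1 * (D t)^-1).
have df (t : R) : is_derive t 1 f (f1 t).
  apply: is_derive_eq (dv_mul (dh t) (dv_inv (D0 t) (dD t))) _.
  rewrite /f1; move: (D t) (D0 t) (h t) (h1 t) (B t) (p2 t) => d d0 *.
  by field.
pose c (t : R) := unfoot phi x (z + t *: v).
pose c1 (t : R) := v - p1 t *: x.
have dc (t : R) i : is_derive t 1 (fun s : R => c s 0 i) (c1 t 0 i).
  have -> : (fun s : R => c s 0 i) = fun s => (z 0 i + s * v 0 i) + - (p s * x 0 i).
    by apply/funext => s; rewrite /c /unfoot !mxE.
  apply: is_derive_eq (dv_add (der_affine _ _ _) (dv_opp (dv_mul (dp t) (dv_cst _ _ _)))) _.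
  by rewrite /c1 !mxE; move: (v 0 i) (x 0 i) (p t) (p1 t) => *; ring.
have c0 t : c t != 0 by exact: unfoot_neq0.
have fE : (fun t : R => F (c t)) = f.
  by apply/funext => t; rewrite (metricF_unfoot phiN x1 phiS psi (zt0 t)) slopeE.
(* The first derivative of [F(c(t))], computed in two ways; [key1] does the same for the second. *)
have gradF (t : R) : grad F (c t) (c1 t) = f1 t.
  apply: (@is_derive_unique f t) => //.
  by rewrite -fE; apply: is_derive_curve => //; exact: smooth_C1.
pose f2 (t : R) := h2 t / D t + (2 * (h1 t * (B t * p2 t)) + h t * (- (a * p2 t) + B t * p3 t)) / D t ^+ 2
  + 2 * h t * (B t * p2 t) ^+ 2 / D t ^+ 3.
have df1 (t : R) : is_derive t 1 f1 (f2 t).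
  have dDi := dv_inv (D0 t) (dD t).
  apply: is_derive_eq (dv_add (dv_mul (dh1 t) dDi)
    (dv_mul (dv_mul (dh t) (dv_mul (dB t) (dp2 t))) (dv_mul dDi dDi))) _.
  rewrite /f2; move: (D t) (D0 t) (h t) (h1 t) (h2 t) (B t) (p2 t) (p3 t) => d d0 *.
  by field.
have dc1 (t : R) i : is_derive t 1 (fun s : R => c1 s 0 i) (- (p2 t * x 0 i)).
  have -> : (fun s : R => c1 s 0 i) = fun s => v 0 i + - (p1 s * x 0 i).
    by apply/funext => s; rewrite /c1 !mxE.
  apply: is_derive_eq (dv_add (dv_cst _ _ _) (dv_opp (dv_mul (dp1 t) (dv_cst _ _ _)))) _.
  by move: (x 0 i) (p1 t) (p2 t) => *; ring.
have dPF (t : R) i : is_derive t 1 (fun s : R => partial i F (c s)) (grad (partial i F) (c t) (c1 t)).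
  by apply: is_derive_curve => //; exact: smooth_partial_C1.
have key1 (t : R) : curvature F (c t) * (det2 (c t) (c1 t) * det2 (c t) (c1 t)) -
    p2 t * grad F (c t) x = f2 t.
  apply: (@is_derive_unique f1 t) => //.
  have -> : f1 = fun s => c1 s 0 0 * partial 0 F (c s) + c1 s 0 1 * partial 1 F (c s).
    by apply/funext => s; rewrite -gradF.
  apply: is_derive_eq (dv_add (dv_mul (dc1 t 0) (dPF t 0)) (dv_mul (dc1 t 1) (dPF t 1))) _.
  have alg (u0 u1 g0 g1 q y0 y1 P0 P1 : R) : u0 * g0 + P0 * (- (q * y0)) + (u1 * g1 + P1 * (- (q * y1)))
    = u0 * g0 + u1 * g1 - q * (y0 * P0 + y1 * P1) by ring.
  by rewrite -(grad2E FS FH (c1 t) (c1 t) (c0 t)); exact: alg.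
have B0 : B 0 = b by rewrite /B mul0r addr0.
have xiE i : x 0 i = a * z 0 i + b * v 0 i by rewrite {1}xE !mxE.
have cE i : c 0 0 i = z 0 i - p 0 * x 0 i.
  by rewrite /c /unfoot -/(p 0) !mxE mul0r addr0.
have c1E i : c1 0 0 i = v 0 i - p1 0 * x 0 i by rewrite /c1 !mxE.
(* Comes from the vector identity [D x = a c + b c'] at [t = 0], together with [dF(c) = F(c)] and
   [dF(c') = f']. *)
have key2 : D 0 * grad F (c 0) x = a * f 0 + b * f1 0.
  rewrite -gradF -[in RHS]fE -(euler1 FS FH (c0 0)) -!gradZ -gradD; congr (grad _ _ _).
  apply/rowP => i; transitivity (D 0 * x 0 i); first by rewrite mxE.
  transitivity (a * c 0 0 i + b * c1 0 0 i); last first.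
    by rewrite [RHS]mxE [X in _ = X + _]mxE [X in _ = _ + X]mxE.
  rewrite cE c1E.
  have alg (d e q u w y : R) : y = a * u + b * w -> d = 1 + - (a * e + b * q) ->
    d * y = a * (u - e * y) + b * (w - q * y) by move=> -> ->; ring.
  by apply: alg (xiE i) _; rewrite /D B0.
have key3 : det2 (c 0) (c1 0) = norm2 z * D 0.
  have alg (z0' z1 v0 v1 x0 x1' q q1 d : R) : x0 = a * z0' + b * v0 -> x1' = a * z1 + b * v1 ->
     d = 1 + - (a * q + b * q1) ->
     (z0' - q * x0) * (v1 - q1 * x1') - (z1 - q * x1') * (v0 - q1 * x0) =
     (z0' * v1 - z1 * v0) * d.
    by move=> -> -> ->; ring.
  rewrite /det2 !cE !c1E -det2_perp -vE; apply: alg (xiE 0) (xiE 1) _.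
  by rewrite /D B0.
(* Elimination of [G = dF(x)] between the two identities, after multiplication by [d ^+ 3]. *)
have final (K n d G g g1 g2 q2 q3 : R) : d != 0 ->
    K * (n * d * (n * d)) - q2 * G =
      g2 / d + (2 * (g1 * (b * q2)) + g * (- (a * q2) + b * q3)) / d ^+ 2
      + 2 * g * (b * q2) ^+ 2 / d ^+ 3 ->
    d * G = a * (g * d^-1) + b * (g1 * d^-1 + g * (b * q2) * (d^-1 * d^-1)) ->
    K * n ^+ 2 * d ^+ 5 =
    g2 * d ^+ 2 + b * d * (3 * g1 * q2 + g * q3) + 3 * g * q2 ^+ 2 * b ^+ 2.
  move=> d0 /(canRL (subrK _)) E1 E2.
  have -> : K * n ^+ 2 * d ^+ 5 = d ^+ 3 * (K * (n * d * (n * d))) by ring.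
  rewrite E1 mulrDr.
  have -> : d ^+ 3 * (q2 * G) = d ^+ 2 * q2 * (d * G) by ring.
  by rewrite E2; field.
rewrite /cone_form -vE -/b.
have zE : z + (0 : R) *: v = z by rewrite scale0r addr0.
have := key1 0; rewrite key3 /f2 B0 => k1.
have := final _ _ _ _ _ _ _ _ _ (D0 0) k1.
rewrite key2 /f /f1 B0 => /(_ erefl).
by rewrite /h2 /h1 /h /p2 /p3 /c -slopeE zE.
Qed.

End curvature_formula.

Section continuity_order.
Context {R : realType} {T : topologicalType}.

Lemma cont_lt (f : T -> R) (x : T) (a : R) :
  {for x, continuous f} -> f x < a -> \forall z \near x, f z < a.
Proof. by move=> fc fa; exact: (cvgr_lt (f x) fc _ fa). Qed.

Lemma cont_gt (f : T -> R) (x : T) (a : R) :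
  {for x, continuous f} -> a < f x -> \forall z \near x, a < f z.
Proof. by move=> fc fa; exact: (cvgr_gt (f x) fc _ fa). Qed.

End continuity_order.

(** * Joint continuity of the quadratic form *)

Section cone_form_continuity.
Context {R : realType} {T : topologicalType}.
Local Notation plane := 'rV[R]_2.
Local Notation U0 := [set y : plane | y != 0].
Variables (zz xx : T -> plane) (t : T).
Hypotheses (zz_cont : {for t, continuous zz}) (xx_cont : {for t, continuous xx}).
Hypothesis zz0 : zz t != 0.

Lemma dirn_cont n (f : plane -> R) (w : T -> plane) : {for t, continuous w} ->
  Ck n U0 f -> {for t, continuous (fun s => dirn n f (w s) (zz s))}.
Proof.
move=> wc; elim: n f => [|n IH] f fC.
  exact: (continuous_comp zz_cont (Ck_cont fC zz0)).
by apply: cont_add; apply: cont_mul; (try exact: cont_coord);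
  exact: IH (Ck_partial _ fC).
Qed.

Lemma perp_cont : {for t, continuous (fun s => perp (zz s))}.
Proof.
apply: cont_plane; apply: forall_ord2.
  rewrite (_ : (fun s => _) = fun s => - zz s 0 1); last by apply/funext => s; rewrite mxE.
  by apply: cont_opp; exact: cont_coord.
rewrite (_ : (fun s => _) = fun s => zz s 0 0); last by apply/funext => s; rewrite mxE.
exact: cont_coord.
Qed.

Lemma cone_coord_cont : {for t, continuous (fun s => cone_coord (zz s) (xx s))}.
Proof.
apply: cont_mul; first apply: cont_add.
- by apply: cont_mul; exact: cont_coord.
- by apply: cont_opp; apply: cont_mul; exact: cont_coord.
apply: cont_inv; first by rewrite gt_eqF ?norm2_gt0.
by apply: cont_add; apply: cont_mul; exact: cont_coord.
Qed.

Lemma slope_cont (phi : plane -> R) : smooth_on U0 phi ->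
  {for t, continuous (fun s => slope phi (xx s) (zz s))}.
Proof.
move=> /smooth_onP phiC; apply: cont_add; first exact: cont_cst.
apply: cont_opp; apply: cont_add; apply: cont_mul; (try exact: cont_coord);
  exact: (continuous_comp zz_cont (Ck_cont (Ck_partial _ (phiC 1%N)) zz0)).
Qed.

(** The parameter space is arbitrary: [z] and [x] both move in [open_locus], whereas [z] is fixed in
    [boundary_degenerate]. *)
Lemma cone_form_cont (psi phi : plane -> R) : smooth_on U0 psi -> smooth_on U0 phi ->
  {for t, continuous (fun s => cone_form psi phi (zz s) (xx s))}.
Proof.
move=> psiS phiS.
have psiC n := dirn_cont (n := n) perp_cont ((smooth_onP _ _).1 psiS n).
have phiC n := dirn_cont (n := n) perp_cont ((smooth_onP _ _).1 phiS n).
have Dc := slope_cont phiS; have bc := cone_coord_cont.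
apply: cont_add; first apply: cont_add.
- by apply: cont_mul; [exact: (psiC 2%N)|exact: cont_mul].
- apply: cont_mul; first exact: cont_mul.
  apply: cont_add; apply: cont_mul; [|exact: (phiC 2%N)|exact: (psiC 0%N)|exact: (phiC 3%N)].
  by apply: cont_mul; [exact: cont_cst|exact: (psiC 1%N)].
- apply: cont_mul; last exact: cont_mul.
  apply: cont_mul; last by apply: cont_mul; exact: (phiC 2%N).
  by apply: cont_mul; [exact: cont_cst|exact: (psiC 0%N)].
Qed.

End cone_form_continuity.

(** * The locus of Minkowski norms *)

Section locus.
Context {R : realType}.
Local Notation plane := 'rV[R]_2.
Local Notation U0 := [set y : plane | y != 0].
Implicit Types (x y z u v p q : plane).
Variables (psi phi : plane -> R).
Hypotheses (phiN : pseudo_norm phi) (phiS : smooth_on U0 phi).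
Hypotheses (psiN : pseudo_norm psi) (psiS : smooth_on U0 psi).
Local Notation Om := (Omega phi).
Local Notation O := (Mink_locus psi phi).
Local Notation Q := (cone_form psi phi).

Section at_point.
Variable x : plane.
Hypothesis x1 : Om x.
Local Notation F := (metricF psi phi x).

Let FS : smooth_on U0 F := metricF_smooth phiN x1 phiS psiS.
Let FH (a : R) y : 0 < a -> F (a *: y) = a * F y := @metricFZ _ _ _ phiN x1 phiS _ psiN a y.
Let F_gt0 y : y != 0 -> 0 < F y := @metricF_gt0 _ _ _ phiN x1 phiS _ psiN y.

Lemma curvature_sign z : z != 0 ->
  exists2 c : R, 0 < c & Q z x = curvature F (unfoot phi x z) * c.
Proof.
move=> z0; exists (norm2 z ^+ 2 * slope phi x z ^+ 5).
  by rewrite mulr_gt0 ?exprn_gt0 ?norm2_gt0//; exact: (slope_gt0 phiN x1 (smooth_C1 phiS z0)).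
by rewrite mulrA; exact/esym/(curvature_metricF phiN phiS psiN psiS x1 z0).
Qed.

Lemma curvature_gt0E z : z != 0 -> (0 < curvature F (unfoot phi x z)) = (0 < Q z x).
Proof. by move=> /curvature_sign[c c0 ->]; rewrite (pmulr_lgt0 _ c0). Qed.

Lemma degenerateE y : y != 0 -> degenerate psi phi x y <-> Q (foot phi x y) x = 0.
Proof.
move=> y0; have z0 : foot phi x y != 0 := foot_neq0 phiN x1 y0.
have [c c0 ->] := curvature_sign z0; rewrite (footK phiN x1).
rewrite /degenerate (hessian_sqr_degenerate FS FH F_gt0 y0).
split=> [/eqP ->|/eqP]; first by rewrite mul0r.
by rewrite mulf_eq0 (gt_eqF c0) orbF.
Qed.

Lemma Mink_locusE : O x <-> forall z, z != 0 -> 0 < Q z x.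
Proof.
have M := Minkowski_normE FS FH F_gt0 (metricF0 phiN x1 psiN).
split=> [[_ /M H] z z0|H].
  by rewrite -curvature_gt0E//; exact/H/(unfoot_neq0 phiN x1).
split=> //; apply/M => y y0; rewrite -(footK phiN x1 y) curvature_gt0E; last exact: foot_neq0.
by apply/H; exact: foot_neq0.
Qed.

(** The curvature is homogeneous of degree -3, so its sign is constant on rays. *)
Lemma curvatureZ_gt0 (a : R) y : 0 < a -> y != 0 ->
  0 < curvature F (a *: y) -> 0 < curvature F y.
Proof.
move=> a0 y0; have a1 : a != 0 by rewrite gt_eqF.
have H i j : partial j (partial i F) (a *: y) = 1 / a * partial j (partial i F) y.
  apply: homog_partial => //; last exact: smooth_partial_C1.
  move=> z; rewrite mul1r; have [->|z0] := eqVneq z 0; first by rewrite scaler0.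
  exact: (partial_homog0 FS FH i z0 a0).
rewrite /curvature !H -mulrDr.
have -> : norm2 (a *: y) = a ^+ 2 * norm2 y.
  by rewrite /norm2 !mxE; move: (y 0 0) (y 0 1) => *; ring.
have ay0 : 0 < (1 / a) * (a ^+ 2)^-1 by rewrite mulr_gt0 ?divr_gt0 ?invr_gt0 ?exprn_gt0.
rewrite invfM mulrACA (pmulr_rgt0 _ ay0).
by [].
Qed.

(** Reduces the condition to a compact set of [z], the unit sphere of the sup norm. *)
Lemma Mink_locus_sphereE : O x <-> forall z, `|z| = 1 -> 0 < Q z x.
Proof.
split=> [/Mink_locusE H z z1|H].
  by apply: H; rewrite -normr_eq0 z1 oner_eq0.
apply/Mink_locusE => z z0; have nz : 0 < `|z| by rewrite normr_gt0.
rewrite -curvature_gt0E//; apply: (@curvatureZ_gt0 (`|z|^-1)).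
- by rewrite invr_gt0.
- exact: (unfoot_neq0 phiN x1).
have -> : `|z|^-1 *: unfoot phi x z = unfoot phi x (`|z|^-1 *: z).
  by rewrite /unfoot (pnZ phiN) ?invr_ge0// scalerBr scalerA.
rewrite curvature_gt0E; last by rewrite scaler_eq0 invr_eq0 negb_or gt_eqF.
by apply: H; rewrite normrZ normfV normr_id mulVf ?gt_eqF.
Qed.

End at_point.

Lemma open_Omega : open Om.
Proof.
rewrite openE => x x1.
have H : \forall z \near x, phi z < 1 := @cont_lt _ _ phi x 1 (@pn_continuous _ _ phiN x) x1.
exact: H.
Qed.

(** The form is jointly continuous and positive on the sphere at [x]; by compactness it stays
    positive there for all nearby [x']. *)
Lemma open_locus : open O.
Proof.
rewrite openE => x [x1 Mx].
have Sc : compact [set z : plane | `|z| = 1].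
  apply: bounded_closed_compact.
    by exists 1; split => // r r1 z /= ->; exact: ltW.
  apply: (@closed_comp _ _ (fun z : plane => `|z|) [set r | r = 1]) => [z _|].
    exact: norm_continuous.
  exact: closed_eq.
have near_Q : \forall x' \near x, [set z : plane | `|z| = 1] `<=` (fun z => 0 < Q z x').
  apply: ((compact_near_coveringP _).1 Sc _ (nbhs x) (fun x' z => 0 < Q z x')) => z /= z1.
  have z0 : z != 0 by rewrite -normr_eq0 z1 oner_eq0.
  have Qc := @cone_form_cont R (plane * plane)%type fst snd (z, x) cvg_fst cvg_snd z0 _ _ psiS phiS.
  have Q0 : 0 < Q z x by have /(Mink_locus_sphereE x1) := conj x1 Mx; exact.
  exact: (cont_gt (Qc _ _) Q0).
near=> x'; apply/Mink_locus_sphereE.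
  by near: x'; exact: open_near open_Omega x1.
by move=> z z1; apply: (near near_Q x').
Unshelve. all: by end_near. Qed.

Lemma convex_Omega p q (t : R) : 0 <= t -> t <= 1 -> Om p -> Om q -> Om ((1 - t) *: p + t *: q).
Proof.
rewrite /Omega /= => t0 t1 p1 q1; have s0 : 0 <= 1 - t by rewrite subr_ge0.
apply: le_lt_trans (pnD phiN _ _) _; rewrite !(pnZ phiN)//.
move: t0; rewrite le_eqVlt => /predU1P[<-|t0]; first by rewrite subr0 mul1r mul0r addr0.
apply: (@lt_le_trans _ _ ((1 - t) * 1 + t * 1)); last by rewrite !mulr1 subrK.
by rewrite ler_ltD// ?ltr_pM2l// ler_wpM2l// ltW.
Qed.

Definition cone_ratio z x := cone_coord z x / slope phi x z.

(** For fixed [z], the sign of the form thus depends on [x] only through [cone_ratio z x]. *)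
Lemma cone_form_ratio z x : Om x -> z != 0 ->
  Q z x = slope phi x z ^+ 2 * (dirn 2 psi (perp z) z +
    cone_ratio z x * (3 * dirn 1 psi (perp z) z * dirn 2 phi (perp z) z + psi z * dirn 3 phi (perp z) z) +
    3 * psi z * dirn 2 phi (perp z) z ^+ 2 * cone_ratio z x ^+ 2).
Proof.
move=> x1 z0; have := slope_gt0 phiN x1 (smooth_C1 phiS z0).
rewrite /cone_form /cone_ratio; move: (slope _ _ _) (cone_coord _ _) => D b D0.
move: (dirn 2 psi _ _) (dirn 1 psi _ _) (dirn 2 phi _ _) (dirn 3 phi _ _) (psi z) => *.
by field; rewrite gt_eqF.
Qed.

Lemma slope_affine z p q (t : R) :
  slope phi ((1 - t) *: p + t *: q) z = (1 - t) * slope phi p z + t * slope phi q z.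
Proof. by rewrite /slope gradD !gradZ; move: (grad _ _ _) (grad _ _ _) => *; ring. Qed.

Lemma cone_coord_affine z p q (t : R) :
  cone_coord z ((1 - t) *: p + t *: q) = (1 - t) * cone_coord z p + t * cone_coord z q.
Proof.
rewrite /cone_coord /det2 !mxE; move: (norm2 z)^-1 => k.
by move: (p 0 0) (p 0 1) (q 0 0) (q 0 1) (z 0 0) (z 0 1) => *; ring.
Qed.

(** A quotient of two affine functions with positive denominator is monotone along a segment. *)
Lemma cone_ratio_between z p q (t : R) : z != 0 -> Om p -> Om q -> 0 <= t -> t <= 1 ->
  cone_ratio z p <= cone_ratio z q ->
  cone_ratio z p <= cone_ratio z ((1 - t) *: p + t *: q) <= cone_ratio z q.
Proof.
move=> z0 p1 q1 t0 t1; have Dp := slope_gt0 phiN p1 (smooth_C1 phiS z0).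
have Dq := slope_gt0 phiN q1 (smooth_C1 phiS z0).
rewrite /cone_ratio slope_affine cone_coord_affine.
move: (slope phi p z) (slope phi q z) (cone_coord z p) (cone_coord z q) Dp Dq => dp dq bp bq Dp Dq.
have s0 : 0 <= 1 - t by rewrite subr_ge0.
have D0 : 0 < (1 - t) * dp + t * dq.
  move: t0; rewrite le_eqVlt => /predU1P[<-|t0]; first by rewrite subr0 mul1r mul0r addr0.
  by rewrite ltr_wpDl ?mulr_gt0// mulr_ge0// ltW.
have cross (a b c d : R) : 0 < b -> 0 < d -> (a / b <= c / d) = (a * d <= c * b).
  by move=> b0 d0; rewrite ler_pdivrMr// mulrAC ler_pdivlMr.
rewrite !cross// => H; apply/andP; split.
  rewrite -subr_ge0 (_ : _ - _ = t * (bq * dp - bp * dq)); last by ring.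
  by rewrite mulr_ge0// subr_ge0.
rewrite -subr_ge0 (_ : _ - _ = (1 - t) * (bq * dp - bp * dq)); last by ring.
by rewrite mulr_ge0// subr_ge0.
Qed.

Lemma cone_ratio_cont z x : z != 0 -> Om x -> {for x, continuous (cone_ratio z)}.
Proof.
move=> z0 x1; have D0 := slope_gt0 phiN x1 (smooth_C1 phiS z0).
have zc : {for x, continuous (fun _ : plane => z)} by apply: cont_plane => i; exact: cont_cst.
have xc : {for x, continuous (fun x : plane => x)} by exact: cvg_id.
apply: cont_mul; first exact: (cone_coord_cont zc xc).
by apply: cont_inv; [rewrite gt_eqF|exact: (slope_cont zc xc)].
Qed.

(** For each [z], the ratios taken on [C] form an interval that contains the ratio at the
    intermediate point [w]. Hence some [c] in [C] has the same ratio, and the form has the same sign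
    at [w] as at [c]. *)
Lemma segment_locus (C : set plane) p q (t : R) : connected C -> C `<=` O ->
  C p -> C q -> 0 <= t -> t <= 1 -> O ((1 - t) *: p + t *: q).
Proof.
move=> cC CO Cp Cq t0 t1.
have Om_C c : C c -> Om c by move=> /CO[].
set w := _ + _; have w1 : Om w by exact: convex_Omega t0 t1 (Om_C _ Cp) (Om_C _ Cq).
apply/(Mink_locusE w1) => z z0.
have rC : is_interval (cone_ratio z @` C).
  apply/connected_intervalP/connected_continuous_connected => //.
  apply: continuous_in_subspaceT => x /set_mem Cx.
  by apply: cone_ratio_cont => //; exact: Om_C.
have [c Cc rcw] : (cone_ratio z @` C) (cone_ratio z w).
  have rp : (cone_ratio z @` C) (cone_ratio z p) by exists p.
  have rq : (cone_ratio z @` C) (cone_ratio z q) by exists q.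
  have [pq|/ltW qp] := leP (cone_ratio z p) (cone_ratio z q).
    by apply: rC rp rq _ _; exact: cone_ratio_between (Om_C _ Cp) (Om_C _ Cq) t0 t1 pq.
  have t0' : 0 <= 1 - t by rewrite subr_ge0.
  have t1' : 1 - t <= 1 by rewrite gerBl.
  have wE : w = (1 - (1 - t)) *: q + (1 - t) *: p by rewrite subKr addrC.
  by rewrite wE; apply: rC rq rp _ _; exact: cone_ratio_between (Om_C _ Cq) (Om_C _ Cp) t0' t1' qp.
have c1 := Om_C _ Cc; have /(Mink_locusE c1)/(_ z z0) := CO _ Cc.
have Dc := slope_gt0 phiN c1 (smooth_C1 phiS z0).
have Dw := slope_gt0 phiN w1 (smooth_C1 phiS z0).
rewrite (cone_form_ratio c1 z0) (cone_form_ratio w1 z0) rcw.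
by rewrite (pmulr_rgt0 _ (exprn_gt0 2 Dc)) (pmulr_rgt0 _ (exprn_gt0 2 Dw)).
Qed.

(** As [y = z - phi z *: x], moving from [x] to [x + t *: y] multiplies both [D] and [b] by
    [k = 1 - t phi(z)], hence the form by [k ^+ 2]: a zero of it persists along the line. *)
Lemma degenerate_line x y (t : R) : Om x -> y != 0 -> degenerate psi phi x y ->
  ~ O (x + t *: y).
Proof.
move=> x1 y0 /(degenerateE x1 y0); set z := foot phi x y => Q0.
have z0 : z != 0 := foot_neq0 phiN x1 y0.
have yE : y = z - phi z *: x by rewrite -[LHS](footK phiN x1).
move=> Oxy; have [w1 _] := Oxy; move/(Mink_locusE w1)/(_ z z0): Oxy.
pose k := 1 - t * phi z.
have DE : slope phi (x + t *: y) z = k * slope phi x z.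
  rewrite /slope yE gradD gradZ gradD -scaleNr gradZ.
  have phiH (a : R) u : 0 < a -> phi (a *: u) = a * phi u.
    by move=> a0; rewrite (pnZ phiN)// ltW.
  rewrite (euler1 phiS phiH z0) /k; move: (grad _ _ _) (phi z) => *; ring.
have bE : cone_coord z (x + t *: y) = k * cone_coord z x.
  rewrite /cone_coord /det2 yE !mxE /k; move: (norm2 z)^-1 (phi z) => *.
  by move: (x 0 0) (x 0 1) (z 0 0) (z 0 1) => *; ring.
have -> : Q z (x + t *: y) = k ^+ 2 * Q z x.
  rewrite /cone_form DE bE; move: (slope _ _ _) (cone_coord _ _) => D b.
  by move: (dirn 2 psi _ _) (dirn 1 psi _ _) (dirn 2 phi _ _) (dirn 3 phi _ _) (psi z) => *; ring.
by rewrite Q0 mulr0 ltxx.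
Qed.

(** Outside the locus the form is nonpositive at some [z]; as a limit of points of the locus, [x]
    also makes it nonnegative there. *)
Lemma boundary_degenerate x : Om x -> closure O x -> ~ O x ->
  exists2 y, y != 0 & degenerate psi phi x y.
Proof.
move=> x1 clx nOx.
have [z [z0 Qz]] : exists z, z != 0 /\ Q z x <= 0.
  apply: contrapT => H; apply: nOx; apply/(Mink_locusE x1) => z z0.
  by rewrite ltNge; apply/negP => Qz; apply: H; exists z.
exists (unfoot phi x z); first exact: (unfoot_neq0 phiN x1).
apply/(degenerateE x1); first exact: (unfoot_neq0 phiN x1).
rewrite (unfootK phiN x1); apply/eqP; rewrite eq_le Qz /= leNgt; apply/negP => Qlt.
have zc : {for x, continuous (fun _ : plane => z)} by apply: cont_plane => i; exact: cont_cst.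
have xc : {for x, continuous (fun x : plane => x)} by exact: cvg_id.
have [w [[w1 Ow] Qw]] := clx _ (cont_lt (cone_form_cont zc xc z0 psiS phiS) Qlt).
have /(Mink_locusE w1)/(_ z z0) := conj w1 Ow.
by move=> /(lt_trans Qw); rewrite ltxx.
Qed.

End locus.

(** * Open convex sets in the plane *)

Section plane_topology.
Context {R : realType}.
Local Notation plane := 'rV[R]_2.
Implicit Types (x y z u v w p q m n : plane) (A B C O : set plane) (s t : R).

Definition seg p q t : plane := (1 - t) *: p + t *: q.

Lemma seg0 p q : seg p q 0 = p.
Proof. by rewrite /seg subr0 scale1r scale0r addr0. Qed.

Lemma seg1 p q : seg p q 1 = q.
Proof. by rewrite /seg subrr scale0r scale1r add0r. Qed.

Lemma segE p q t : seg p q t = p + t *: (q - p).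
Proof. by apply/rowP => i; rewrite !mxE; move: (p 0 i) (q 0 i) => *; ring. Qed.

Lemma seg_cont p q t : {for t, continuous (seg p q)}.
Proof.
apply: cont_plane => i.
rewrite (_ : (fun s => _) = fun s : R => p 0 i + s * (q 0 i - p 0 i)); last first.
  by apply/funext => s; rewrite segE !mxE.
apply: cont_add; first exact: cont_cst.
by apply: cont_mul; [exact: cvg_id|exact: cont_cst].
Qed.

Definition segment p q : set plane := seg p q @` `[0, 1].

Lemma segment_connected_plane p q : connected (segment p q).
Proof.
apply: connected_continuous_connected; first exact: segment_connected.
by apply: continuous_subspaceT => t; exact: seg_cont.
Qed.

Definition cvx A := forall p q t, A p -> A q -> 0 <= t -> t <= 1 -> A (seg p q t).

Lemma cvx_convex_set A : cvx A -> convex_set (A : set (convex_lmodType plane)).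
Proof.
move=> cA p q l /set_mem Ap /set_mem Aq; apply/mem_set.
(* The end points are exchanged because [seg] puts its parameter on the second point. *)
have := cA q p l%:num Aq Ap (ge0 l) (le1 l).
rewrite /seg addrC; exact.
Qed.

Lemma cvx_connected A x : A x -> cvx A -> connected A.
Proof.
move=> Ax cA.
have -> : A = \bigcup_(y in A) segment x y.
  apply/seteqP; split => [y Ay|_ [y Ay [t /= + <-]]].
    by exists y => //; exists 1; rewrite ?seg1//= in_itv/= ler01 lexx.
  by rewrite in_itv/= => /andP[t0 t1]; exact: cA.
apply: bigcup_connected; last by move=> y _; exact: segment_connected_plane.
by exists x => y _; exists 0; rewrite ?seg0//= in_itv/= ler01 lexx.
Qed.

Lemma cvx_ball x (r : R) : cvx (ball x r).
Proof.
move=> p q t; rewrite -ball_normE /= => px qx t0 t1.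
have s0 : 0 <= 1 - t by rewrite subr_ge0.
have -> : x - seg p q t = seg (x - p) (x - q) t.
  by apply/rowP => i; rewrite !mxE; move: (p 0 i) (q 0 i) (x 0 i) => *; ring.
apply: le_lt_trans (ler_normD _ _) _; rewrite !normrZ (ger0_norm t0) (ger0_norm s0).
move: t0; rewrite le_eqVlt => /predU1P[<-|t0]; first by rewrite subr0 mul1r mul0r addr0.
apply: (@lt_le_trans _ _ ((1 - t) * r + t * r)); last by rewrite -mulrDl subrK mul1r.
by rewrite ler_ltD// ?ltr_pM2l// ler_wpM2l// ltW.
Qed.

Lemma open_ballP A x : open A -> A x -> exists2 r : R, 0 < r & ball x r `<=` A.
Proof. by move=> oA Ax; apply/nbhs_ballP; exact: open_nbhs_nbhs. Qed.

Lemma open_component O x : open O -> open (connected_component O x).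
Proof.
move=> oO; rewrite openE => z Cz.
have [r r0 br] := open_ballP oO (connected_component_sub Cz).
apply/nbhs_ballP; exists r => //= w zw.
rewrite (same_connected_component Cz).
apply: connected_component_max br _ _ zw; first exact: ballxx.
by apply: (@cvx_connected _ z); [exact: ballxx|exact: cvx_ball].
Qed.

(** A segment between two points of a component lies in [O] and is connected, so it stays in that
    component. *)
Lemma cvx_component O x :
  (forall C p q t, connected C -> C `<=` O -> C p -> C q -> 0 <= t -> t <= 1 -> O (seg p q t)) ->
  cvx (connected_component O x).
Proof.
move=> H p q t Cp Cq t0 t1; rewrite (same_connected_component Cp).
apply: (@connected_component_max _ _ (segment p q)).
- by exists 0; rewrite ?seg0//= in_itv/= ler01 lexx.
- move=> _ [s /= + <-]; rewrite in_itv/= => /andP[s0 s1].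
  apply: H Cp Cq s0 s1; first exact: component_connected.
  exact: connected_component_sub.
- exact: segment_connected_plane.
- by exists t => //=; rewrite in_itv/= t0 t1.
Qed.

Definition rat_point (q : rat * rat) : plane := \row_i ratr (if i == 0 then q.1 else q.2).

Lemma open_rat_point A x : open A -> A x -> exists q : rat * rat, A (rat_point q).
Proof.
move=> oA /(open_ballP oA)[r r0 br].
have rat_near (a : R) : exists q : rat, `|a - ratr q| < r.
  have /rat_in_itvoo[q] : a - r < a + r by lra.
  by rewrite in_itv/= => /andP[q1 q2]; exists q; rewrite ltr_norml; apply/andP; split; lra.
have [q0 h0] := rat_near (x 0 0); have [q1 h1] := rat_near (x 0 1).
exists (q0, q1); apply: br; rewrite -ball_normE /=.
by apply: norm_plane_lt => //; rewrite !mxE.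
Qed.

Lemma component_rat_point O C : open O -> components O C ->
  exists q : rat * rat, C = connected_component O (rat_point q).
Proof.
move=> oO [x Ox <-].
have [q Cq] := open_rat_point (open_component oO) (connected_component_refl Ox).
by exists q; exact: same_connected_component.
Qed.

Lemma boundary_openE A x : open A -> boundary A x <-> closure A x /\ ~ A x.
Proof. by move=> /interior_id; rewrite /boundary => ->. Qed.

(** Otherwise the trace of [A] on the segment would be both open and closed in it, against
    connectedness. *)
Lemma segment_boundary A p q : open A -> A p -> ~ A q ->
  exists t, [/\ 0 <= t, t <= 1 & boundary A (seg p q t)].
Proof.
move=> oA Ap Aq; apply: contrapT => H; apply: Aq.
have E : segment p q `&` A = segment p q `&` closure A.
  apply/seteqP; split => z [sz Az]; split => //; first exact: subset_closure.
  apply: contrapT => nAz; apply: H; move: sz => [t /= + tz].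
  rewrite in_itv/= => /andP[t0 t1]; exists t; split => //.
  by rewrite tz; apply/boundary_openE.
have sp : segment p q p by exists 0; rewrite ?seg0//= in_itv/= ler01 lexx.
have sq : segment p q q by exists 1; rewrite ?seg1//= in_itv/= ler01 lexx.
have : segment p q `&` A = segment p q.
  apply: segment_connected_plane; first by exists p.
  - by exists A.
  - by exists (closure A) => //; exact: closed_closure.
by move=> Eq; have [] : (segment p q `&` A) q by rewrite Eq.
Qed.

(** Replacing [x] by a point [x'] of [C] within [r * t] is compensated by moving [w] to [w'], which
    stays in the ball of radius [r] around [w]. *)
Lemma cvx_closure_seg C x w t : open C -> cvx C -> closure C x -> C w ->
  0 < t -> t <= 1 -> C (x + t *: (w - x)).
Proof.
move=> oC cC clx Cw t0 t1; have [r r0 br] := open_ballP oC Cw.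
have [x' [Cx' xx']] := clx _ (nbhsx_ballx x (r * t) (mulr_gt0 r0 t0)).
move: xx'; rewrite -ball_normE /= => xx'.
have tn0 : t != 0 by rewrite gt_eqF.
pose w' : plane := w + ((1 - t) / t) *: (x - x').
have -> : x + t *: (w - x) = seg x' w' t.
  apply/rowP => i; rewrite !mxE; move: (x 0 i) (x' 0 i) (w 0 i) => *; field.
  by [].
apply: cC => //; last exact: ltW.
apply: br; rewrite -ball_normE /= /w' opprD addNKr normrN normrZ.
have k0 : 0 <= (1 - t) / t by rewrite divr_ge0 ?subr_ge0// ltW.
rewrite (ger0_norm k0) mulrAC ltr_pdivrMr//; apply: le_lt_trans xx'.
by rewrite ler_piMl// gerBl ltW.
Qed.

Lemma perp_neq0 u : u != 0 -> det2 u (perp u) != 0.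
Proof. by move=> u0; rewrite det2_perp gt_eqF ?norm2_gt0. Qed.

Lemma det2D m u v : det2 m (u + v) = det2 m u + det2 m v.
Proof. by rewrite /det2 !mxE; move: (m 0 0) (m 0 1) (u 0 0) (u 0 1) (v 0 0) (v 0 1) => *; ring. Qed.

Lemma det2Z m t u : det2 m (t *: u) = t * det2 m u.
Proof. by rewrite /det2 !mxE; move: (m 0 0) (m 0 1) (u 0 0) (u 0 1) => *; ring. Qed.

Lemma det2N m u : det2 m (- u) = - det2 m u.
Proof. by rewrite -scaleN1r det2Z mulN1r. Qed.

Lemma det2Dl u v m : det2 (u + v) m = det2 u m + det2 v m.
Proof. by rewrite /det2 !mxE; move: (m 0 0) (m 0 1) (u 0 0) (u 0 1) (v 0 0) (v 0 1) => *; ring. Qed.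

Lemma det2Zl t u m : det2 (t *: u) m = t * det2 u m.
Proof. by rewrite /det2 !mxE; move: (m 0 0) (m 0 1) (u 0 0) (u 0 1) => *; ring. Qed.

Lemma det2Nl m u : det2 (- m) u = - det2 m u.
Proof. by rewrite -scaleN1r det2Zl mulN1r. Qed.

Lemma det2uu u : det2 u u = 0.
Proof. by rewrite /det2 mulrC subrr. Qed.

Lemma det2_cont m x : {for x, continuous (det2 m)}.
Proof.
apply: cont_add; last apply: cont_opp;
  by apply: cont_mul; [exact: cont_cst|exact: coord_continuous].
Qed.

Lemma det2_contl u x : {for x, continuous (fun m => det2 m u)}.
Proof.
apply: cont_add; last apply: cont_opp;
  by apply: cont_mul; [exact: coord_continuous|exact: cont_cst].
Qed.

Definition misses C x v := forall t, ~ C (x + t *: v).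

Lemma missesN C x v : misses C x v -> misses C x (- v).
Proof. by move=> H t; rewrite scalerN -scaleNr; exact: H. Qed.

(** If the affine function [det2 v (p - x)] took both signs on [C], the zero of it on a segment of
    [C] would be a point of the line. That zero has parameter [a / (a - b)]. *)
Lemma misses_side C x v : cvx C -> v != 0 -> misses C x v ->
  (forall p, C p -> 0 < det2 v (p - x)) \/ (forall p, C p -> 0 < det2 (- v) (p - x)).
Proof.
move=> cC v0 mis; have d0 p : C p -> det2 v (p - x) != 0.
  move=> Cp; apply/eqP => /(det2_eq0 v0)[k kE]; apply: (mis k).
  by rewrite -kE subrKC.
have [[p [Cp dp]]|H] := pselect (exists p, C p /\ 0 < det2 v (p - x)); last first.
  right=> p Cp; rewrite det2Nl oppr_gt0 lt_neqAle d0//= leNgt.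
  by apply/negP => dp; apply: H; exists p.
left=> q Cq; rewrite lt_neqAle eq_sym d0//= leNgt; apply/negP => dq.
set a := det2 v (p - x) in dp; set b := det2 v (q - x) in dq.
have ab : 0 < a - b by rewrite subr_gt0 (lt_trans dq).
have t0 : 0 <= a / (a - b) by rewrite divr_ge0// ltW.
have t1 : a / (a - b) <= 1 by rewrite ler_pdivrMr// mul1r lerBrDr gerDl ltW.
have := d0 _ (cC _ _ _ Cp Cq t0 t1); rewrite segE addrAC det2D det2Z.
have -> : q - p = (q - x) - (p - x) by rewrite opprB addrA subrK.
rewrite det2D det2N -/a -/b; apply/negP; rewrite negbK; apply/eqP; field.
by rewrite gt_eqF.
Qed.

Lemma closure_side C x v p : (forall p, C p -> 0 < det2 v (p - x)) ->
  closure C p -> 0 <= det2 v (p - x).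
Proof.
move=> H clp; rewrite leNgt; apply/negP => dp.
have c : {for p, continuous (fun p => det2 v (p - x))}.
  rewrite (_ : (fun p => _) = fun p => det2 v p + det2 v (- x)); last first.
    by apply/funext => q; rewrite det2D.
  by apply: cont_add; [exact: det2_cont|exact: cont_cst].
have [q [Cq]] := clp _ (cont_lt c dp).
by move=> /(lt_trans (H _ Cq)); rewrite ltxx.
Qed.

(* The points where the linear form [det2 m] has its strict minimum on [closure C]. *)
Definition exposed C m : set plane :=
  [set x | closure C x /\ forall p, closure C p -> p != x -> 0 < det2 m (p - x)].

Lemma exposed_subsingleton C m x y : exposed C m x -> exposed C m y -> x = y.
Proof.
move=> [clx Hx] [cly Hy]; apply/eqP; apply/negPn/negP => xy.
have := Hx y cly; rewrite eq_sym => /(_ xy); have := Hy x clx xy.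
by rewrite -opprB det2N oppr_gt0 => /lt_trans /[apply]; rewrite ltxx.
Qed.

(** Once signs are adjusted, [det2 v] and [det2 w] both have their minimum over the closure at [x].
    By independence every combination with positive coefficients has a strict minimum there, and
    such combinations form an open set, which contains a rational point. *)
Lemma corner_exposed C x v w : cvx C -> closure C x -> det2 v w != 0 ->
  misses C x v -> misses C x w -> exists q : rat * rat, exposed C (rat_point q) x.
Proof.
move=> cC clx; wlog Hv : v / forall p, C p -> 0 < det2 v (p - x).
  move=> IH vw mv mw; have [H|H] := misses_side cC (det2_neq0 vw) mv.
    exact: IH H vw mv mw.
  by apply: IH H _ (missesN mv) mw; rewrite det2Nl oppr_eq0.
wlog Hw : w / forall p, C p -> 0 < det2 w (p - x).
  move=> IH vw mv mw.
  have w0 : w != 0 by apply: contra_neq vw => ->; rewrite /det2 !mxE !mulr0 subrr.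
  have [H|H] := misses_side cC w0 mw; first exact: IH H vw mv mw.
  by apply: IH H _ mv (missesN mw); rewrite det2N oppr_eq0.
move=> vw _ _; set D := det2 v w in vw.
(* Cramer's rule for the coordinates of [m] in the basis [v], [w]. *)
pose al (m : plane) := det2 m w * D^-1; pose be (m : plane) := det2 v m * D^-1.
have mE m : m = al m *: v + be m *: w.
  apply: plane_eqP; rewrite !mxE /al /be; move: vw; rewrite /D /det2;
    move: (m 0 0) (m 0 1) (v 0 0) (v 0 1) (w 0 0) (w 0 1) => *; field => //.
have cal : {for v + w, continuous al}.
  by apply: cont_mul; [exact: det2_contl|exact: cont_cst].
have cbe : {for v + w, continuous be}.
  by apply: cont_mul; [exact: det2_cont|exact: cont_cst].
have al1 : 0 < al (v + w).
  rewrite /al (_ : det2 (v + w) w = D) ?divff//.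
  by rewrite /D /det2 !mxE; move: (v 0 0) (v 0 1) (w 0 0) (w 0 1) => *; ring.
have be1 : 0 < be (v + w) by rewrite /be det2D det2uu add0r divff.
have : nbhs (v + w) [set m | 0 < al m /\ 0 < be m].
  by apply: filterI; [exact: cont_gt cal al1|exact: cont_gt cbe be1].
rewrite nbhsE => -[B [oB Bvw] BS].
have [q /BS/= [aq bq]] := open_rat_point oB Bvw.
exists q; split => // p clp px; rewrite (mE (rat_point q)).
rewrite det2Dl !det2Zl.
have dv := closure_side Hv clp; have dw := closure_side Hw clp.
have av := mulr_ge0 (ltW aq) dv; have bw := mulr_ge0 (ltW bq) dw.
move: (al _) (be _) aq bq av bw => a b aq bq av bw.
rewrite lt_neqAle (addr_ge0 av bw) andbT eq_sym (paddr_eq0 av bw) !mulf_eq0 (gt_eqF aq) (gt_eqF bq) /=.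
apply/negP => /andP[/eqP/(det2_eq0 (det2_neq0 vw))[k kE]].
rewrite kE det2Z (_ : det2 w v = - D); last first.
  by rewrite /D /det2; move: (v 0 0) (v 0 1) (w 0 0) (w 0 1) => *; ring.
rewrite mulf_eq0 oppr_eq0 (negPf vw) orbF => /eqP k0.
by move: px; rewrite -subr_eq0 kE k0 scale0r eqxx.
Qed.

(** If [x + t *: v] were in [C], then [t > 0], and a boundary point [p] near [x] in a direction
    close to [v] would lie on a segment from [x] to a point of [C], hence in [C] itself. *)
Lemma tangent_cone_supports C x y v : open C -> cvx C -> boundary C x ->
  (forall p, C p -> 0 < det2 y (p - x)) -> tangent_cone (boundary C) x v -> misses C x v.
Proof.
move=> oC cC /(boundary_openE _ oC)[clx nCx] Hy Tv t Cw.
have v0 : v != 0 by apply/eqP => v0; apply: nCx; rewrite v0 scaler0 addr0 in Cw.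
have dv : 0 <= det2 y v.
  rewrite leNgt; apply/negP => dv.
  have /nbhs_ballP[e /= e0 He] := cont_lt (@det2_cont y v) dv.
  have [p [r [/(boundary_openE _ oC)[clp _] r0 _ pv]]] := Tv e e0.
  have : ball v e (r *: (p - x)) by rewrite -ball_normE /= distrC.
  by move=> /He; rewrite det2Z pmulr_rlt0// ltNge (closure_side Hy clp).
have t0 : 0 < t.
  have := Hy _ Cw; rewrite addrAC subrr add0r det2Z; move: dv.
  rewrite le_eqVlt => /predU1P[<-|dv]; first by rewrite mulr0 ltxx.
  by rewrite pmulr_lgt0.
have [rho rho0 brho] := open_ballP oC Cw.
have nv : 0 < `|v| by rewrite normr_gt0.
(* The first bound puts [x + (t * r) *: (p - x)] in [C]; the second forces [t * r >= 1], so that [p]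
   lies between [x] and that point. *)
pose e := Num.min (rho / t) (`|v| / (1 + t^-1)).
have t1 : 0 < 1 + t^-1 by rewrite ltr_wpDl// invr_gt0.
have e0 : 0 < e by rewrite lt_min !divr_gt0.
have [p [r [/(boundary_openE _ oC)[clp nCp] r0 pe pv]]] := Tv e e0.
have Cq : C (x + (t * r) *: (p - x)).
  apply: brho; rewrite -ball_normE /= opprD addrACA subrr add0r -scalerA -scalerBr normrZ.
  rewrite (gtr0_norm t0) mulrC -ltr_pdivlMr// distrC; apply: lt_le_trans pv _.
  by rewrite /e ge_min lexx.
have tr1 : 1 <= t * r.
  have ev : e * (1 + t^-1) <= `|v| by rewrite -ler_pdivlMr// /e ge_min lexx orbT.
  have : `|v| < r * e + e.
    rewrite -(subrKC (r *: (p - x)) v); apply: le_lt_trans (ler_normD _ _) _.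
    rewrite ltrD ?(distrC v)//; first by rewrite normrZ (gtr0_norm r0) ltr_pM2l.
  move=> /(le_lt_trans ev); rewrite mulrDr mulr1 addrC ltrD2r (mulrC r) ltr_pM2l// => tr.
  by rewrite -ler_pdivrMl// mulr1 ltW.
apply: nCp; have tr0 : 0 < t * r by rewrite mulr_gt0.
have := cvx_closure_seg oC cC clx Cq (t := (t * r)^-1).
rewrite invr_gt0 tr0 invf_le1// tr1 => /(_ erefl erefl).
by rewrite [_ - x]addrAC subrr add0r scalerA mulVf ?gt_eqF// scale1r subrKC.
Qed.

(** If no boundary point approaches [x] in a direction close to [u], the supporting line can be
    tilted a little towards [C] and still misses it. Otherwise the boundary would be crossed between
    the tilted and the untilted line, near [x] and in a direction close to [u]. *)
Lemma support_tangent_cone C x y u : open C -> cvx C -> boundary C x ->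
  (forall p, C p -> 0 < det2 y (p - x)) -> misses C x u -> det2 y u = 0 -> u != 0 ->
  ~ tangent_cone (boundary C) x u -> exists2 v, misses C x v & det2 y v != 0.
Proof.
move=> oC cC /(boundary_openE _ oC)[clx nCx] Hy mu yu u0 nTu.
have [e [e0 He]] : exists e : R, 0 < e /\ forall p (r : R), boundary C p -> 0 < r ->
    `|p - x| < e -> `|r *: (p - x) - u| < e -> False.
  apply: contrapT => H; apply: nTu => e e0; apply: contrapT => H'.
  by apply: H; exists e; split => // p r *; apply: H'; exists p, r.
have [[w Cw]|C0] := pselect (exists w, C w); last first.
  have [y0|y0] := eqVneq y 0.
    by have [z [Cz _]] := clx _ (nbhsx_ballx x 1 ltr01); case: C0; exists z.
  by exists (perp y); [move=> t Ct; apply: C0; exists (x + t *: perp y)|exact: perp_neq0].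
have y0 : y != 0 by exact: det2_neq0 (lt0r_neq0 (Hy _ Cw)).
pose n := perp y; have nn : det2 y n = norm2 y by exact: det2_perp.
have n2 : 0 < norm2 y by exact: norm2_gt0.
pose eps := e / (`|n| + 1); have n1 : 0 < `|n| + 1 by rewrite ltr_wpDl.
have eps0 : 0 < eps by rewrite divr_gt0.
have epsn : eps * `|n| < e by rewrite /eps mulrAC ltr_pdivrMr// ltr_pM2l// ltrDl.
exists (u + eps *: n); last first.
  by rewrite det2D yu add0r det2Z nn mulf_neq0 ?gt_eqF.
move=> t Ct; have [t0|t0] := leP t 0.
  have := Hy _ Ct; rewrite addrAC subrr add0r det2Z det2D yu add0r det2Z nn.
  by rewrite ltNge mulr_le0_ge0// mulr_ge0// ltW.
(* Small enough for the crossing point [p] to lie within [e] of [x]. *)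
pose tau := Num.min t (e / (`|u| + e)).
have ue : 0 < `|u| + e by rewrite ltr_wpDl.
have tau0 : 0 < tau by rewrite lt_min t0 divr_gt0.
have taut : tau / t <= 1 by rewrite ler_pdivrMr// mul1r /tau ge_min lexx.
have Cq : C (x + tau *: (u + eps *: n)).
  have := cvx_closure_seg oC cC clx Ct (divr_gt0 tau0 t0) taut.
  by rewrite [_ - x]addrAC subrr add0r scalerA divfK ?gt_eqF.
have [l [l0 l1 bl]] := segment_boundary oC Cq (mu tau).
move: bl; set p := seg _ _ _ => bl.
have pE : p - x = tau *: (u + ((1 - l) * eps) *: n).
  rewrite /p /seg; apply/rowP => i; rewrite !mxE.
  by move: (x 0 i) (u 0 i) (n 0 i) => *; ring.
have ln : `|((1 - l) * eps) *: n| < e.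
  rewrite normrZ; apply: le_lt_trans epsn; apply: ler_wpM2r => //.
  have l1' : 0 <= 1 - l by rewrite subr_ge0.
  rewrite ger0_norm; last by rewrite mulr_ge0 ?(ltW eps0).
  by rewrite ler_piMl ?(ltW eps0)// gerBl.
apply: (He p tau^-1) => //.
- by rewrite invr_gt0.
- rewrite pE normrZ (gtr0_norm tau0).
  apply: (@lt_le_trans _ _ (tau * (`|u| + e))).
    rewrite ltr_pM2l//; apply: le_lt_trans (ler_normD _ _) _; by rewrite ltrD2l.
  by rewrite -ler_pdivlMr// /tau ge_min lexx orbT.
- by rewrite pE scalerA mulVf ?gt_eqF// scale1r addrAC subrr add0r.
Qed.

(** Tangent vectors span missing lines, hence are multiples of [y]. Conversely, a multiple of [y]
    that is not tangent would allow a tilt, that is, a second missing line. *)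
Lemma unique_support_tangent C x y : open C -> cvx C -> boundary C x ->
  y != 0 -> misses C x y -> (forall v, misses C x v -> det2 y v = 0) ->
  tangent_line (boundary C) x y.
Proof.
move=> oC cC bx y0 my Hv; split => //.
have [s [s0 Hs]] : exists s : R, s != 0 /\ forall p, C p -> 0 < det2 (s *: y) (p - x).
  have [H|H] := misses_side cC y0 my; first by exists 1; rewrite oner_eq0 scale1r.
  by exists (-1); rewrite oppr_eq0 oner_eq0 scaleN1r.
apply/seteqP; split => [v Tv|_ [t _ <-]].
  have := Hv v (tangent_cone_supports oC cC bx Hs Tv).
  by move=> /(det2_eq0 y0)[k ->]; exists k.
have [->|t0] := eqVneq t 0.
  move=> e e0; exists x, 1; split => //; rewrite subrr ?scaler0 ?scale0r ?subrr normr0//.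
apply: contrapT => nT.
have mty : misses C x (t *: y) by move=> r; rewrite scalerA; exact: my.
have ty0 : t *: y != 0 by rewrite scaler_eq0 negb_or t0.
have dty : det2 (s *: y) (t *: y) = 0 by rewrite det2Zl det2Z det2uu !mulr0.
have [v mv] := support_tangent_cone oC cC bx Hs mty dty ty0 nT.
by rewrite det2Zl Hv// mulr0 eqxx.
Qed.

(** A segment that crosses the boundary near [x] still crosses it after small sideways translations.
    The crossing points have distinct transverse coordinates, which fill an interval. *)
Lemma boundary_uncountable C U x : open C -> cvx C -> open U ->
  boundary C x -> U x -> ~ countable (boundary C `&` U).
Proof.
move=> oC cC oU /(boundary_openE _ oC)[clx nCx] Ux cnt.
have [r r0 br] := open_ballP oU Ux.
have r2 : 0 < r / 2 by rewrite divr_gt0.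
have [c [Cc xc]] := clx _ (nbhsx_ballx x (r / 2) r2).
move: xc; rewrite -ball_normE /= => xc.
pose u := x - c; have u0 : u != 0.
  by rewrite /u subr_eq0; apply/eqP => xE; apply: nCx; rewrite xE.
(* The reflection of [c] in [x]; if it were in the closure of [C], the midpoint [x] would be in
   [C]. *)
pose z := x + u; have nclz : ~ closure C z.
  move=> clz; apply: nCx.
  have h0 : (0 : R) < 1 / 2 by rewrite divr_gt0.
  have h1 : (1 / 2 : R) <= 1 by rewrite ler_pdivrMr// mul1r ler1n.
  have := cvx_closure_seg oC cC clz Cc h0 h1.
  rewrite (_ : _ + _ = x)// /z /u; apply/rowP => i; rewrite !mxE.
  by move: (x 0 i) (c 0 i) => *; field.
have oV : open (~` closure C) by rewrite openC; exact: closed_closure.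
pose n := perp u; have nn : det2 u n = norm2 u by exact: det2_perp.
have n2 : 0 < norm2 u by exact: norm2_gt0.
have ccont p : {for (0 : R), continuous (fun s : R => p + s *: n)}.
  apply: cont_plane => i.
  rewrite (_ : (fun s => _) = fun s : R => p 0 i + s * n 0 i); last first.
    by apply/funext => s; rewrite !mxE.
  by apply: cont_add; [exact: cont_cst|apply: cont_mul; [exact: cvg_id|exact: cont_cst]].
have near0 A p : open A -> A p -> \forall s \near (0 : R), A (p + s *: n).
  by move=> oA Ap; apply: (ccont p); apply: open_nbhs_nbhs; rewrite scale0r addr0.
have bc : ball x r c.
  by rewrite -ball_normE /=; apply: lt_trans xc _; rewrite ltr_pdivrMr// ltr_pMr// ltr1n.
have bz : ball x r z.
  rewrite -ball_normE /= /z opprD addNKr normrN; apply: lt_trans xc _.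
  by rewrite ltr_pdivrMr// ltr_pMr// ltr1n.
have ob : open (ball x r) by exact: ball_open.
have : \forall s \near (0 : R), [/\ C (c + s *: n), (~` closure C) (z + s *: n),
    ball x r (c + s *: n) & ball x r (z + s *: n)].
  near=> s; split; near: s; exact: near0.
move=> /nbhs_ballP[d /= d0 Hd].
(* The coordinate transverse to the segments: it is [s] on the one translated by [s *: n]. *)
pose g p := (det2 u p - det2 u c) / norm2 u.
have sub : `]0, d[%classic `<=` g @` (boundary C `&` U).
  move=> s /=; rewrite in_itv/= => /andP[s0 sd].
  have : ball (0 : R) d s by rewrite -ball_normE /= sub0r normrN gtr0_norm.
  move=> /Hd[Cs nCs bcs bzs].
  have nCzs : ~ C (z + s *: n) by move=> /(@subset_closure _ C).
  have [t [t0 t1 bt]] := segment_boundary oC Cs nCzs.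
  exists (seg (c + s *: n) (z + s *: n) t).
    by split => //; apply: br; exact: cvx_ball.
  have -> : seg (c + s *: n) (z + s *: n) t = c + (s *: n + (2 * t) *: u).
    rewrite /seg /z /u; apply/rowP => i; rewrite !mxE.
    by move: (x 0 i) (c 0 i) (n 0 i) => *; ring.
  by rewrite /g !det2D !det2Z det2uu mulr0 addr0 nn addrAC subrr add0r mulfK// gt_eqF.
have cI : countable (`]0, d[%classic : set R).
  apply: sub_countable (subset_card_le sub) _.
  exact: sub_countable (card_image_le _ _) cnt.
have := countable_lebesgue_measure0 cI.
rewrite lebesgue_measure_itv /= lte_fin d0 oppr0 adde0 => /eqP.
by rewrite eqe gt_eqF.
Unshelve. all: by end_near. Qed.

End plane_topology.

(** * Hausdorff measure of countable sets *)

Section hausdorff_countable.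
Context {R : realType}.
Local Notation plane := 'rV[R]_2.
Local Open Scope ereal_scope.

Lemma diam_subsingleton (U : set plane) :
  (forall p q, U p -> U q -> p = q) -> diam U = 0.
Proof.
move=> H; rewrite /diam (_ : _ `|` _ = [set 0]) ?ereal_sup1//.
apply/seteqP; split => [d [//|[p [q [Up Uq ->]]]]|d ->]; last by left.
rewrite (H p q Up Uq) subrr /euclid.
rewrite big1 ?sqrtr0// => k _; by rewrite mxE expr0n.
Qed.

(** The fibres of an injection into [nat] cover the set by pieces of diameter 0, admissible at every
    scale. *)
Lemma hausdorff1_countable (A : set plane) : countable A -> hausdorff1 A = 0.
Proof.
move=> cA; rewrite /hausdorff1.
have [U AU U1] : exists2 U : nat -> set plane, A `<=` \bigcup_i U i &
    forall i p q, U i p -> U i q -> p = q.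
  have /countable_injP[f injf] := cA.
  exists (fun i => [set p | A p /\ f p = i]); first by move=> p Ap; exists (f p).
  move=> i p q [Ap fp] [Aq fq]; apply: injf; rewrite ?inE//; exact: etrans (esym fq).
have content0 (d : R) : (0 < d)%R -> hausdorff1_content d A = 0.
  move=> d0; apply/eqP; rewrite eq_le; apply/andP; split.
    apply: ereal_inf_lbound; exists U; last first.
      by apply: eseries0 => i _ _; exact: diam_subsingleton (U1 i).
    by split => // i; rewrite diam_subsingleton ?lee_fin ?ltW//; exact: U1.
  apply: le_ereal_inf_tmp => _ [V _ <-]; apply: nneseries_ge0 => i _ _.
  by apply: ereal_sup_ubound; left.
rewrite (_ : [set _ | _ in _] = [set 0]) ?ereal_sup1//.
apply/seteqP; split => [_ [d d0 <-]|_ ->]; first exact: content0.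
by exists 1%R; [exact: ltr01|apply: content0; exact: ltr01].
Qed.

End hausdorff_countable.

(** * Conclusion *)

Section conclusion.
Context {R : realType}.
Local Notation plane := 'rV[R]_2.
Local Notation U0 := [set y : plane | y != 0].
Implicit Types (x y : plane) (C : set plane).
Variables (psi phi : plane -> R).
Hypotheses (phiN : pseudo_norm phi) (phiS : smooth_on U0 phi).
Hypotheses (psiN : pseudo_norm psi) (psiS : smooth_on U0 psi).
Local Notation Om := (Omega phi).
Local Notation O := (Mink_locus psi phi).

Let oO : open O := open_locus phiN phiS psiN psiS.

Lemma component_open C : components O C -> open C.
Proof. by move=> [x _ <-]; exact: open_component. Qed.

Lemma component_cvx C : components O C -> cvx C.
Proof.
move=> [x _ <-]; apply: cvx_component => A p q t cA AO Ap Aq t0 t1.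
exact: (segment_locus phiN phiS psiN psiS cA AO Ap Aq t0 t1).
Qed.

(** A pair of rational points names a component, by a point of it, and a linear form. The union
    contains every point of a component's boundary with two independent lines missing that
    component. *)
Definition corners : set plane :=
  \bigcup_(qr : (rat * rat) * (rat * rat))
    exposed (connected_component O (rat_point qr.1)) (rat_point qr.2).

Lemma corners_countable : countable corners.
Proof.
apply: bigcup_countable => [|qr _]; first exact: countableP.
have [[x Ex]|E0] := pselect (exists x, exposed (connected_component O (rat_point qr.1)) (rat_point qr.2) x).
  apply: sub_countable (countable1 x); apply: subset_card_le => y Ey.
  exact: exposed_subsingleton Ey Ex.
by rewrite (_ : exposed _ _ = set0) // -subset0 => x Ex; apply: E0; exists x.
Qed.

(** The line misses all of [O], hence each component adherent to [x]. A second independent missing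
    line would make [x] a corner, so the support is unique. *)
Lemma degenerate_tangent x y : Om x -> ~ corners x -> y != 0 ->
  degenerate psi phi x y -> tangent_to_boundary O x y.
Proof.
move=> x1 ncx y0 dxy.
have mis t : ~ O (x + t *: y) by exact: (degenerate_line phiN phiS psiN psiS x1 y0 dxy).
split; [exact: y0|by apply/nbhs_ballP; exists 1 => //= t _; exact: mis|].
move=> C OC bx; have oC := component_open OC; have cC := component_cvx OC.
have CO : C `<=` O by case: OC => z _ <-; exact: connected_component_sub.
have my : misses C x y by move=> t /CO; exact: mis.
apply: unique_support_tangent => // v mv; apply/eqP/negPn/negP => yv.
have [clx _] := (boundary_openE x oC).1 bx.
have [m Em] := corner_exposed cC clx yv my mv.
have [q CE] := component_rat_point oO OC.
by apply: ncx; exists (q, m) => //=; rewrite -CE.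
Qed.

(** A boundary point of [C] is not in [O]: otherwise its own component, being open, would meet [C]
    and coincide with it. *)
Lemma component_boundary_degenerate C x : components O C -> boundary C x -> Om x ->
  boundary O x /\ exists2 y, y != 0 & degenerate psi phi x y.
Proof.
move=> OC bx x1; have oC := component_open OC.
have [clx nCx] := (boundary_openE x oC).1 bx.
have CO : C `<=` O by case: OC => z _ <-; exact: connected_component_sub.
have clOx : closure O x by exact: closureS CO _ clx.
have nOx : ~ O x.
  move=> Ox; have Dx := connected_component_refl Ox.
  have [z [Cz Dz]] := clx _ (open_nbhs_nbhs (conj (open_component oO) Dx)).
  apply: nCx; case: OC Cz => w _ <- Cz.
  exact: connected_component_trans Cz (connected_component_sym Dz).
split; first exact/(boundary_openE _ oO).
exact: (boundary_degenerate phiN phiS psiN psiS x1 clOx nOx).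
Qed.

(** Components may accumulate at [x] without any of them being adherent to it. A segment from a
    point of [O] to [x] nevertheless leaves the component where it starts, inside [Omega] by
    convexity. *)
Lemma exists_component_boundary x : boundary O x -> Om x ->
  exists C z, [/\ components O C, boundary C z & Om z].
Proof.
move=> /(boundary_openE _ oO)[clx nOx] x1.
have [w [Ow _]] := clx _ filterT.
have OC : components O (connected_component O w) by exists w.
have nCx : ~ connected_component O w x by move=> /connected_component_sub.
have [t [t0 t1 bz]] := segment_boundary (component_open OC) (connected_component_refl Ow) nCx.
exists (connected_component O w), (seg w x t); split; [exact: OC|exact: bz|].
by apply: (convex_Omega phiN t0 t1 _ x1); case: Ow.
Qed.

End conclusion.

Theorem theorem3p17 (R : realType) (psi phi : 'rV[R]_2 -> R)
    (psiM : Minkowski_norm psi) (phiW : weak_Minkowski_norm phi) :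
  let O := Mink_locus psi phi in
  let dO := boundary O `&` Omega phi in
  (forall C, components O C -> domain C /\ convex_set C) /\
  H1_ae_in dO (fun x => forall y, y != 0 -> degenerate psi phi x y ->
                 tangent_to_boundary O x y) /\
  (dO !=set0 -> exists x y,
     [/\ dO x, y != 0, degenerate psi phi x y, tangent_to_boundary O x y &
         exists2 C, components O C & boundary C x]).
Proof.
have [[psiN psiS _] _] := psiM; have [phiN phiS _] := phiW.
move=> O dO; split; [|split].
- move=> C OC; split; last exact/cvx_convex_set/(component_cvx phiN phiS psiN psiS OC).
  split; last 2 first.
  + exact: (component_open phiN phiS psiN psiS OC).
  + by case: OC => x _ <-; exact: component_connected.
  by case: OC => x Ox <-; exists x; exact: connected_component_refl.
- apply: hausdorff1_countable.
  (* All exceptional points are corners. *)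
  apply: sub_countable (corners_countable psi phi); apply: subset_card_le => x [[bx x1] nT].
  apply: contrapT => ncx; apply: nT => y y0 dxy.
  exact: (degenerate_tangent phiN phiS psiN psiS x1 ncx y0 dxy).
move=> [x [bx x1]].
have [C [z [OC bz z1]]] := exists_component_boundary phiN phiS psiN psiS bx x1.
have oC := component_open phiN phiS psiN psiS OC.
have cC := component_cvx phiN phiS psiN psiS OC.
have unc := boundary_uncountable oC cC (open_Omega phiN) bz z1.
(* Uncountably many boundary points of [C] lie in [Omega], so one of them is not a corner. *)
have [w [bw w1 ncw]] : exists w, [/\ boundary C w, Omega phi w & ~ corners psi phi w].
  apply: contrapT => H; apply: unc; apply: sub_countable (corners_countable psi phi).
  apply: subset_card_le => w [bw w1]; apply: contrapT => ncw.
  by apply: H; exists w.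
have [bOw [y y0 dwy]] := component_boundary_degenerate phiN phiS psiN psiS OC bw w1.
exists w, y; split; [split; [exact: bOw|exact: w1]|exact: y0|exact: dwy| |by exists C].
exact: (degenerate_tangent phiN phiS psiN psiS w1 ncw y0 dwy).
Qed.
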